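(* Let $X$ be a locally compact Hausdorff space and let $A$ be a Banach algebra. Then the following statements hold. (i) $C_0(X,A)$ is amenable if and only if $A$ is amenable. (ii) $C_0(X,A)$ is 0-point amenable if and only if $A$ is 0-point amenable. (iii) If $A$ is commutative, then $C_0(X,A)$ is weakly amenable if and only if $A$ is weakly amenable.
   Context: $C_0(X,A)$ is the Banach algebra of continuous functions $X\to A$ vanishing at infinity, with pointwise multiplication and the supremum norm. Let $B$ be a Banach algebra with character space $\Delta(B)$ (nonzero multiplicative linear functionals $B\to\mathbb{C}$). A derivation from $B$ into a Banach $B$-bimodule $E$ is a linear map $D$ with $D(ab)=D(a)b+aD(b)$; it is inner if there is $z\in E$ with $D(a)=az-za$ for all $a$. $B$ is amenable if for every Banach $B$-bimodule $E$ every continuous derivation $B\to E^*$ is inner, and weakly amenable if every continuous derivation $B\to B^*$ is inner. For $\varphi\in\Delta(B)\cup\{0\}$, a continuous point derivation at $\varphi$ is a continuous linear functional $d:B\to\mathbb{C}$ with $d(ab)=\varphi(a)d(b)+\varphi(b)d(a)$. $B$ is 0-point amenable if for every $\varphi\in\Delta(B)\cup\{0\}$ the only continuous point derivation at $\varphi$ is zero.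
   Formalization: The space X is assumed to be non-empty; for X empty, C_0(X,A) is zero and has all three properties, so the equivalences fail when, for example, A is the complex numbers with zero product. *)

(* Defs.v *)
From HB Require Import structures.
From mathcomp Require Import all_boot all_order all_algebra.
From mathcomp Require Import all_classical all_reals all_analysis.
From mathcomp Require Import complex.

Set Implicit Arguments.
Unset Strict Implicit.
Unset Printing Implicit Defensive.

Import Order.TTheory GRing.Theory Num.Theory.
Import numFieldNormedType.Exports.
Local Open Scope classical_set_scope.
Local Open Scope ring_scope.

Section ComplexNorm.
Variable R : realType.
Local Open Scope complex_scope.

(* The norm of a [normedModType R[i]] is [R[i]]-valued; this is its real part. *)
Definition rnorm (V : normedModType R[i]) (v : V) : R := complex.Re `|v|.

Lemma rnormE (V : normedModType R[i]) (v : V) : `|v| = (rnorm v)%:C.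
Proof. by rewrite /rnorm RRe_real // ger0_real. Qed.

Lemma ge0_ReE (M : R[i]) : 0 <= M -> M = (complex.Re M)%:C.
Proof. by move=> M0; rewrite RRe_real // ger0_real. Qed.

Lemma rnorm_leP (V : normedModType R[i]) (v : V) (M : R[i]) :
  0 <= M -> (`|v| <= M) = (rnorm v <= complex.Re M).
Proof. by move=> M0; rewrite rnormE [in LHS](ge0_ReE M0) lecR. Qed.

Lemma rnorm_ge0 (V : normedModType R[i]) (v : V) : 0 <= rnorm v.
Proof. by rewrite -ler0c -rnormE. Qed.

Lemma rnorm_continuous (V : normedModType R[i]) : continuous (@rnorm V).
Proof.
move=> v; apply/cvgrPdist_lt => e e0.
have e0' : 0 < e%:C :> R[i] by rewrite ltcR.
have /cvgrPdist_lt/(_ _ e0') := @cvg_id _ (nbhs v).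
apply: filterS => w /=; rewrite rnormE ltcR; apply: le_lt_trans.
have tri (a b : V) : rnorm a <= rnorm (a - b) + rnorm b.
  by rewrite -lecR rmorphD/= -!rnormE -[X in `|X| <= _](subrK b) ler_normD.
have sym : rnorm (v - w) = rnorm (w - v) by rewrite /rnorm distrC.
by rewrite ler_norml lerBlDr tri andbT lerNl opprB sym lerBlDr tri.
Qed.

Lemma Re_le_norm (z : R[i]) : `|complex.Re z| <= complex.Re `|z|.
Proof.
case: z => a b; rewrite normc_def /= -sqrtr_sqr ler_sqrt ?lerDl ?sqr_ge0//.
by rewrite addr_ge0 ?sqr_ge0.
Qed.

Lemma Im_le_norm (z : R[i]) : `|complex.Im z| <= complex.Re `|z|.
Proof.
case: z => a b; rewrite normc_def /= -sqrtr_sqr ler_sqrt ?lerDr ?sqr_ge0//.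
by rewrite addr_ge0 ?sqr_ge0.
Qed.

Lemma norm_le_ReIm (z : R[i]) :
  `|z| <= (`|complex.Re z| + `|complex.Im z|)%:C.
Proof.
case: z => a b; rewrite normc_def lecR/=.
rewrite -[leRHS]ger0_norm ?addr_ge0// -sqrtr_sqr ler_sqrt ?sqr_ge0//.
by rewrite sqrrD !real_normK ?num_real// lerD2r lerDl mulrn_wge0// mulr_ge0.
Qed.

Lemma complex_complete (F : set_system (R[i])^o) :
  ProperFilter F -> cauchy F -> cvg F.
Proof.
move=> FF /cauchyP FC.
have comp (p : R[i] -> R) : (forall x y, p (x - y) = p x - p y) ->
    (forall z, `|p z| <= complex.Re `|z|) -> cvg (p @ F).
  move=> pB ple; apply/cauchy_cvgP/cauchyP => e e0.
  have [x Fx] := FC e%:C ltac:(by rewrite ltcR).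
  exists (p x); apply: (@filterS _ F _ _ _ _ Fx) => y.
  rewrite -!ball_normE /= -pB (ge0_ReE (normr_ge0 _)) ltcR.
  exact/le_lt_trans/ple.
have BRe : forall x y : R[i], complex.Re (x - y) = complex.Re x - complex.Re y.
  by move=> -[? ?] [? ?].
have cRe := comp _ BRe Re_le_norm.
have BIm : forall x y : R[i], complex.Im (x - y) = complex.Im x - complex.Im y.
  by move=> -[? ?] [? ?].
have cIm := comp _ BIm Im_le_norm.
apply/cvg_ex; exists (Complex (lim (@complex.Re R @ F)) (lim (@complex.Im R @ F))).
apply/fcvgrPdist_lt => e e0.
have e20 : 0 < complex.Re e / 2.
  by rewrite divr_gt0// -ltcR -ge0_ReE// ltW.
move/cvgrPdist_lt/(_ _ e20): cRe => cRe.
move/cvgrPdist_lt/(_ _ e20): cIm => cIm.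
apply: filterS2 cRe cIm => -[a b] /= ha hb.
apply: le_lt_trans (norm_le_ReIm _) _.
by rewrite [ltRHS]ge0_ReE 1?ltW// ltcR/= (splitr (complex.Re e)) ltrD.
Qed.

Definition supnorm (T : Type) (V : normedModType R[i]) (D : set T) (f : T -> V)
  : R := sup [set rnorm (f t) | t in D].

Lemma supnorm_ub (T : Type) (V : normedModType R[i]) (D : set T) (f : T -> V)
    (M : R[i]) (t : T) :
  (forall t, D t -> `|f t| <= M) -> D t -> `|f t| <= (supnorm D f)%:C.
Proof.
move=> fM Dt; rewrite rnormE lecR; apply: ub_le_sup; last by exists t.
exists (complex.Re M) => _ [s Ds <-]; rewrite -rnorm_leP ?fM//.
exact: le_trans (fM _ Ds).
Qed.

Lemma supnorm_le (T : Type) (V : normedModType R[i]) (D : set T) (f : T -> V)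
    (M : R[i]) :
  0 <= M -> (forall t, D t -> `|f t| <= M) -> (supnorm D f)%:C <= M.
Proof.
move=> M0 fM; rewrite [leRHS](ge0_ReE M0) lecR.
have [[t Dt]|/nonemptyPn ->] := pselect (D !=set0); last first.
  by rewrite /supnorm image_set0 sup0 -ler0c -ge0_ReE.
apply: ge_sup; first by exists (rnorm (f t)), t.
by move=> _ [s Ds <-]; rewrite -rnorm_leP ?fM.
Qed.

Lemma supnorm_ge0 (T : Type) (V : normedModType R[i]) (D : set T) (f : T -> V) :
  0 <= (supnorm D f)%:C :> R[i].
Proof.
rewrite lecR /supnorm; have [hs|/sup_out->//] := pselect (has_sup [set rnorm (f t) | t in D]).
have [[_ [t Dt _]] hu] := hs.
by apply: le_trans (rnorm_ge0 (f t)) _; apply: ub_le_sup => //; exists t.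
Qed.

Lemma le_eps (a b : R[i]) : 0 <= a -> 0 <= b ->
  (forall e : R[i], 0 < e -> a <= b + e) -> a <= b.
Proof.
move=> a0 b0 h; rewrite (ge0_ReE a0) (ge0_ReE b0) lecR.
apply/ler_addgt0Pr => e e0; have := h e%:C ltac:(by rewrite ltcR).
by rewrite {1}(ge0_ReE a0) {1}(ge0_ReE b0) -rmorphD lecR.
Qed.

(* A Cauchy filter of functions, for a norm dominating pointwise evaluation up
   to the weight [w], converges uniformly relative to [w]. *)
Lemma cauchy_fun_limit (T : Type) (V N : normedModType R[i]) (w : T -> R[i])
    (ev : N -> T -> V) (F : set_system N) :
  (forall G : set_system V, ProperFilter G -> cauchy G -> cvg G) ->
  (forall t, 0 <= w t) ->
  (forall f g t, `|ev f t - ev g t| <= `|f - g| * w t) ->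
  ProperFilter F -> cauchy F ->
  exists l : T -> V, forall e : R[i], 0 < e ->
    \forall f \near F, forall t, `|ev f t - l t| <= e * w t.
Proof.
move=> Vc w0 evw FF /cauchyP FC.
have cl t : cvg (ev^~ t @ F).
  apply: Vc; apply/cauchyP => e e0.
  have w1 : 0 < w t + 1 by rewrite ltr_wpDl.
  have [x Fx] := FC (e / (w t + 1)) (divr_gt0 e0 w1).
  exists (ev x t); apply: (@filterS _ F _ _ _ _ Fx) => y.
  rewrite -!ball_normE /= ltr_pdivlMr// => xy.
  apply: le_lt_trans (evw _ _ _) _; apply: le_lt_trans xy.
  by rewrite ler_wpM2l// lerDl.
exists (fun t => lim (ev^~ t @ F)) => e e0.
have [x Fx] := FC (e / 2) (divr_gt0 e0 (ltr0n _ 2)).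
apply: (@filterS _ F _ _ _ _ Fx) => f xf t.
apply: le_eps => [//||d d0]; first by rewrite mulr_ge0// ltW.
have /cvgrPdist_lt/(_ _ d0) ld := cl t.
have [g [/= lg xg]] := filter_ex (filterI ld Fx).
rewrite -[X in `|X| <= _](subrKA (ev g t)).
apply: le_trans (ler_normD _ _) _; rewrite lerD//; last by rewrite distrC ltW.
apply: le_trans (evw _ _ _) _; rewrite ler_wpM2r// ltW//.
move: xf xg; rewrite -!ball_normE /= => xf xg.
rewrite -(subrKA x) [e]splitr; apply: le_lt_trans (ler_normD _ _) _.
by rewrite ltrD// distrC.
Qed.

End ComplexNorm.

(* No unit is assumed, so the multiplication is not that of a ring structure. *)
HB.mixin Record isBanachAlgebra (R : realType) B
    & CompleteNormedModule R[i] B := {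
  bmul : B -> B -> B;
  bmulA : associative bmul;
  bmulDl : left_distributive bmul +%R;
  bmulDr : right_distributive bmul +%R;
  bscalerAl : forall (k : R[i]) (a b : B), k *: bmul a b = bmul (k *: a) b;
  bscalerAr : forall (k : R[i]) (a b : B), k *: bmul a b = bmul a (k *: b);
  bnormM : forall a b : B, `|bmul a b| <= `|a| * `|b|
}.

#[short(type="banachAlgType")]
HB.structure Definition BanachAlgebra (R : realType) :=
  {B of isBanachAlgebra R B & CompleteNormedModule R[i] B}.

Section BanachAlgebraTheory.
Variables (R : realType) (B : banachAlgType R).
Implicit Types a b c : B.

Lemma bmulNl a b : bmul (- a) b = - bmul a b.
Proof. by rewrite -scaleN1r -bscalerAl scaleN1r. Qed.

Lemma bmulNr a b : bmul a (- b) = - bmul a b.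
Proof. by rewrite -scaleN1r -bscalerAr scaleN1r. Qed.

Lemma bmulBB a b c d : bmul a b - bmul c d = bmul a (b - d) + bmul (a - c) d.
Proof. by rewrite bmulDr bmulDl bmulNr bmulNl addrA subrK. Qed.

Lemma continuous_bmul (X : topologicalType) (f g : X -> B) :
  continuous f -> continuous g -> continuous (fun x => bmul (f x) (g x)).
Proof.
move=> cf cg x; apply/cvgrPdist_lt => e e0.
pose M := `|f x| + `|g x| + 1.
have M0 : 0 < M by rewrite ltr_wpDl.
have d0 : 0 < e / 2 / M by rewrite !divr_gt0.
have /cvgrPdist_lt/(_ _ d0) hf := cf x.
have /cvgrPdist_lt/(_ _ d0) hg := cg x.
have /cvgrPdist_lt/(_ _ ltr01) hg1 := cg x.
apply: filterS3 hf hg hg1 => y hf hg hg1 /=.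
rewrite bmulBB [e]splitr.
apply: le_lt_trans (ler_normD _ _) _; apply: ltrD.
  apply: le_lt_trans (bnormM _ _) _; apply: le_lt_trans (_ : _ <= M * _) _.
    by apply: ler_wpM2r => //; rewrite /M -addrA lerDl addr_ge0.
  by rewrite mulrC -ltr_pdivlMr.
apply: le_lt_trans (bnormM _ _) _; apply: le_lt_trans (_ : _ <= _ * M) _.
  apply: ler_wpM2l => //; rewrite -[g y](subKr (g x)).
  apply: le_trans (ler_normB _ _) _; apply: le_trans (lerD (lexx _) (ltW hg1)) _.
  by rewrite /M -addrA lerDr.
by rewrite -ltr_pdivlMr.
Qed.

End BanachAlgebraTheory.

Definition vanishes_at_infinity (R : realType) (X : topologicalType)
    (V : normedModType R[i]) (f : X -> V) :=
  forall e : R[i], 0 < e ->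
    exists2 K : set X, compact K & forall x, ~ K x -> `|f x| < e.

Definition C0_pred (R : realType) (X : topologicalType)
    (V : completeNormedModType R[i]) : {pred X -> V} :=
  fun f => `[< continuous f /\ vanishes_at_infinity f >].

Record C0 (R : realType) (X : topologicalType)
    (V : completeNormedModType R[i]) := MkC0 {
  C0_fun :> X -> V;
  C0_funP : C0_fun \in @C0_pred R X V
}.

Section C0Space.
Variables (R : realType) (X : topologicalType) (V : completeNormedModType R[i]).
Local Open Scope complex_scope.

HB.instance Definition _ := [isSub for @C0_fun R X V].
HB.instance Definition _ := [Choice of C0 X V by <:].

Lemma C0_submod_closed : submod_closed (@C0_pred R X V).
Proof.
split=> [|k f g].
  apply/asboolP; split; first by move=> x; exact: cvg_cst.
  by move=> e e0; exists set0; [exact: compact0|move=> x _; rewrite normr0].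
move=> /asboolP[cf vf] /asboolP[cg vg]; apply/asboolP; split.
  move=> x; apply: (@continuousD _ _ _ (k \*: f) g); last exact: cg.
  exact/continuousZl_tmp/cf.
move=> e e0; have k0 : 0 < `|k| + 1 by rewrite ltr_wpDl.
have [K cK fK] := vf (e / 2 / (`|k| + 1)) ltac:(by rewrite !divr_gt0).
have [L cL gL] := vg (e / 2) ltac:(by rewrite divr_gt0).
exists (K `|` L); first exact: compactU.
move=> x /not_orP[Kx Lx]; rewrite [e]splitr.
apply: le_lt_trans (ler_normD _ _) _; apply: ltrD; last exact: gL.
rewrite normrZ; apply: le_lt_trans (_ : _ <= (`|k| + 1) * _) _.
  by apply: ler_wpM2r => //; rewrite lerDl.
by rewrite mulrC -ltr_pdivlMr// fK.
Qed.

HB.instance Definition _ := GRing.isSubmodClosed.Build R[i] (X -> V)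
  (@C0_pred R X V) C0_submod_closed.
HB.instance Definition _ := [SubChoice_isSubLmodule of C0 X V by <:].

Lemma C0_continuous (f : C0 X V) : continuous f.
Proof. by have /asboolP[] := C0_funP f. Qed.

Lemma C0_vanishes (f : C0 X V) : vanishes_at_infinity f.
Proof. by have /asboolP[] := C0_funP f. Qed.

Lemma C0_bounded (f : C0 X V) : exists M : R[i], forall x, `|f x| <= M.
Proof.
have [K cK fK] := C0_vanishes f ltr01.
have cn : {within K, continuous (fun x => rnorm (f x) : R^o)}.
  apply: continuous_subspaceT => x.
  exact: (continuous_comp (@C0_continuous f x) (@rnorm_continuous _ _ _)).
have /compact_bounded/pinfty_ex_gt0[M _ hM] := continuous_compact cn cK.
exists (Num.max M 1)%:C => x; rewrite rnormE lecR le_max.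
have [Kx|/fK] := pselect (K x); last first.
  by rewrite rnormE ltcR => /ltW ->; rewrite orbT.
by apply/orP; left; rewrite -[leLHS]ger0_norm ?rnorm_ge0//; apply: hM; exists x.
Qed.

Definition C0_norm (f : C0 X V) : R[i] := (supnorm [set: X] f)%:C.

Lemma C0_norm_ub (f : C0 X V) x : `|f x| <= C0_norm f.
Proof. by have [M hM] := C0_bounded f; apply: (@supnorm_ub _ _ _ _ _ M). Qed.

Lemma C0_norm_le (f : C0 X V) M : 0 <= M -> (forall x, `|f x| <= M) ->
  C0_norm f <= M.
Proof. by move=> M0 fM; apply: supnorm_le => // x _; exact: fM. Qed.

Lemma C0_ler_normD f g : C0_norm (f + g) <= C0_norm f + C0_norm g.
Proof.
apply: C0_norm_le => [|x]; first by rewrite addr_ge0 ?supnorm_ge0.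
by rewrite (le_trans (ler_normD _ _))// lerD// C0_norm_ub.
Qed.

Lemma C0_normrZ (k : R[i]) f : C0_norm (k *: f) = `|k| * C0_norm f.
Proof.
have le c h : C0_norm (c *: h) <= `|c| * C0_norm h.
  apply: C0_norm_le => [|x]; first by rewrite mulr_ge0 ?supnorm_ge0.
  by rewrite normrZ ler_wpM2l// C0_norm_ub.
apply/eqP; rewrite eq_le le /=; have [->|k0] := eqVneq k 0.
  by rewrite normr0 mul0r supnorm_ge0.
rewrite -ler_pdivlMl ?normr_gt0// -normfV.
by rewrite -[X in C0_norm X <= _](scalerK k0) le.
Qed.

Lemma C0_normr0_eq0 f : C0_norm f = 0 -> f = 0.
Proof.
move=> f0; apply/val_inj/funext => x; apply/eqP.
by rewrite -normr_le0 -f0 C0_norm_ub.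
Qed.

HB.instance Definition _ := Lmodule_isNormed.Build R[i] (C0 X V)
  C0_ler_normD C0_normrZ C0_normr0_eq0.

Lemma C0_complete (F : set_system (C0 X V)) :
  ProperFilter F -> cauchy F -> cvg F.
Proof.
move=> FF FC.
have w0 (x : X) : 0 <= 1 :> R[i] by [].
have evw (f g : C0 X V) x : `|f x - g x| <= `|f - g| * 1.
  by rewrite mulr1; exact: (C0_norm_ub (f - g)).
have [l lP] := cauchy_fun_limit (@cauchy_cvg V) w0 evw FF FC.
have l0 : l \in @C0_pred R X V.
  apply/asboolP; split.
    move=> x; apply/cvgrPdist_lt => e e0.
    have e4 : 0 < e / 2 / 2 by rewrite !divr_gt0.
    have [f hf] := filter_ex (lP _ e4).
    have /cvgrPdist_lt/(_ _ (divr_gt0 e0 (ltr0n _ 2))) := @C0_continuous f x.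
    apply: filterS => y hy.
    have -> : l x - l y = (l x - f x) + ((f x - f y) + (f y - l y)).
      by rewrite !addrA !subrK.
    have -> : e = e / 2 / 2 + (e / 2 + e / 2 / 2) by rewrite addrCA -!splitr.
    apply: le_lt_trans (ler_normD _ _) _; apply: ler_ltD.
      by rewrite distrC; have := hf x; rewrite mulr1.
    apply: le_lt_trans (ler_normD _ _) _; apply: ltr_leD => //.
    by have := hf y; rewrite mulr1.
  move=> e e0; have e2 : 0 < e / 2 by rewrite divr_gt0.
  have [f hf] := filter_ex (lP _ e2).
  have [K cK fK] := C0_vanishes f e2; exists K => // x Kx.
  rewrite -[l x](subrK (f x)) [e]splitr; apply: le_lt_trans (ler_normD _ _) _.
  apply: ler_ltD; last exact: fK.
  by rewrite distrC; have := hf x; rewrite mulr1.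
apply/cvg_ex; exists (MkC0 l0); apply/fcvgrPdist_lt => e e0.
have e2 : 0 < e / 2 by rewrite divr_gt0.
apply: filterS (lP _ e2) => f hf; apply: le_lt_trans (_ : _ <= e / 2) _.
  apply: C0_norm_le => [|x]; first exact: ltW.
  by have := hf x; rewrite mulr1 distrC.
by rewrite ltr_pdivrMr// ltr_pMr// ltr1n.
Qed.

HB.instance Definition _ := Uniform_isComplete.Build (C0 X V) C0_complete.

End C0Space.

Section C0Algebra.
Variables (R : realType) (X : topologicalType) (A : banachAlgType R).
Implicit Types f g h : C0 X A.

Lemma C0_mul_subproof f g : (fun x => bmul (f x) (g x)) \in @C0_pred R X A.
Proof.
apply/asboolP; split; first by apply: continuous_bmul; exact: C0_continuous.
move=> e e0; have n0 : 0 < `|f| + 1 by rewrite ltr_wpDl.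
have [K cK gK] := C0_vanishes g (divr_gt0 e0 n0).
exists K => // x /gK; rewrite ltr_pdivlMr// mulrC => gx.
apply: le_lt_trans (bnormM _ _) (le_lt_trans _ gx); apply: ler_wpM2r => //.
by apply: le_trans (C0_norm_ub f x) _; rewrite lerDl.
Qed.

Definition C0_mul f g : C0 X A := MkC0 (C0_mul_subproof f g).

Lemma C0_mulA : associative C0_mul.
Proof. by move=> f g h; apply/val_inj/funext => x; exact: bmulA. Qed.

Lemma C0_mulDl : left_distributive C0_mul +%R.
Proof. by move=> f g h; apply/val_inj/funext => x; exact: bmulDl. Qed.

Lemma C0_mulDr : right_distributive C0_mul +%R.
Proof. by move=> f g h; apply/val_inj/funext => x; exact: bmulDr. Qed.

Lemma C0_scalerAl (k : R[i]) f g : k *: C0_mul f g = C0_mul (k *: f) g.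
Proof. by apply/val_inj/funext => x; exact: bscalerAl. Qed.

Lemma C0_scalerAr (k : R[i]) f g : k *: C0_mul f g = C0_mul f (k *: g).
Proof. by apply/val_inj/funext => x; exact: bscalerAr. Qed.

Lemma C0_normM f g : `|C0_mul f g| <= `|f| * `|g|.
Proof.
apply: C0_norm_le => [|x]; first exact: mulr_ge0.
by apply: le_trans (bnormM _ _) _; rewrite ler_pM//; exact: C0_norm_ub.
Qed.

HB.instance Definition _ := isBanachAlgebra.Build R (C0 X A)
  C0_mulA C0_mulDl C0_mulDr C0_scalerAl C0_scalerAr C0_normM.

End C0Algebra.

Definition dual_pred (R : realType) (E : normedModType R[i])
    : {pred E -> (R[i])^o} :=
  fun f => `[< linear f /\ continuous f >].

Record dual (R : realType) (E : normedModType R[i]) := MkDual {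
  dual_fun :> E -> (R[i])^o;
  dual_funP : dual_fun \in @dual_pred R E
}.

Section DualSpace.
Variables (R : realType) (E : normedModType R[i]).
Local Open Scope complex_scope.

HB.instance Definition _ := [isSub for @dual_fun R E].
HB.instance Definition _ := [Choice of dual E by <:].

Lemma dual_submod_closed : submod_closed (@dual_pred R E).
Proof.
split=> [|k f g].
  apply/asboolP; split; last by move=> x; exact: cvg_cst.
  by move=> c x y; rewrite /= scaler0 addr0.
move=> /asboolP[lf cf] /asboolP[lg cg]; apply/asboolP; split.
  move=> c x y; rewrite !fctE lf lg !scalerDr addrACA.
  by rewrite !scalerA [k * c]mulrC.
move=> x; apply: (@continuousD _ _ _ (k \*: f) g); last exact: cg.
exact/continuousZl_tmp/cf.
Qed.

HB.instance Definition _ := GRing.isSubmodClosed.Build R[i] (E -> (R[i])^o)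
  (@dual_pred R E) dual_submod_closed.
HB.instance Definition _ := [SubChoice_isSubLmodule of dual E by <:].

Lemma dual_linear (f : dual E) : linear f.
Proof. by have /asboolP[] := dual_funP f. Qed.

Lemma dual_continuous (f : dual E) : continuous f.
Proof. by have /asboolP[] := dual_funP f. Qed.

HB.instance Definition _ (f : dual E) :=
  GRing.isLinear.Build R[i] E (R[i])^o _ (dual_fun f) (dual_linear f).

Lemma dual_predP (f : E -> (R[i])^o) (M : R[i]) :
  linear f -> (forall x, `|f x| <= M * `|x|) -> f \in @dual_pred R E.
Proof.
move=> lf fM; apply/asboolP; split=> //.
pose lf' := GRing.isLinear.Build R[i] E (R[i])^o _ f lf.
pose g : {linear E -> (R[i])^o} := HB.pack f lf'.
apply: (@bounded_linear_continuous _ _ _ g); apply/ex_bound; exists `|M|.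
apply/nbhs_norm0P; exists 1 => //= x /= x1; apply: le_trans (fM x) _.
have [->|x0] := eqVneq x 0; first by rewrite normr0 mulr0.
have M0 : 0 <= M.
  by rewrite -(pmulr_lge0 _ (_ : 0 < `|x|)) ?normr_gt0// (le_trans _ (fM x)).
by rewrite ger0_norm// ler_piMr// ltW.
Qed.

Lemma dual_bounded (f : dual E) : exists2 M : R[i], 0 < M &
  forall x, `|f x| <= M * `|x|.
Proof.
have /linear_bounded_continuous/linear_boundedP := @dual_continuous f.
by move=> /pinfty_ex_gt0.
Qed.

Definition dual_norm (f : dual E) : R[i] :=
  (supnorm [set x : E | `|x| <= 1] f)%:C.

Lemma dual_norm_ub (f : dual E) x : `|f x| <= dual_norm f * `|x|.
Proof.
have [M M0 hM] := dual_bounded f.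
have [->|x0] := eqVneq x 0; first by rewrite linear0 !normr0 mulr0.
have nx0 : 0 < `|x| by rewrite normr_gt0.
rewrite -ler_pdivrMr// mulrC -[X in X * _]gtr0_norm ?invr_gt0// -normrM.
have -> : `|x|^-1 * f x = f (`|x|^-1 *: x) by rewrite linearZ.
apply: (@supnorm_ub _ _ _ _ _ M) => [y /= y1|/=].
  by apply: le_trans (hM y) _; rewrite ler_piMr// ltW.
by rewrite normrZ gtr0_norm ?invr_gt0// mulVf// gt_eqF.
Qed.

Lemma dual_norm_le (f : dual E) M : 0 <= M -> (forall x, `|f x| <= M * `|x|) ->
  dual_norm f <= M.
Proof.
move=> M0 fM; apply: supnorm_le => // x /= x1.
by apply: le_trans (fM x) _; rewrite ler_piMr.
Qed.

Lemma dual_ler_normD f g : dual_norm (f + g) <= dual_norm f + dual_norm g.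
Proof.
apply: dual_norm_le => [|x]; first by rewrite addr_ge0 ?supnorm_ge0.
by rewrite mulrDl (le_trans (ler_normD _ _))// lerD// dual_norm_ub.
Qed.

Lemma dual_normrZ (k : R[i]) f : dual_norm (k *: f) = `|k| * dual_norm f.
Proof.
have le c h : dual_norm (c *: h) <= `|c| * dual_norm h.
  apply: dual_norm_le => [|x]; first by rewrite mulr_ge0 ?supnorm_ge0.
  by rewrite normrZ -mulrA ler_wpM2l// dual_norm_ub.
apply/eqP; rewrite eq_le le /=; have [->|k0] := eqVneq k 0.
  by rewrite normr0 mul0r supnorm_ge0.
rewrite -ler_pdivlMl ?normr_gt0// -normfV.
by rewrite -[X in dual_norm X <= _](scalerK k0) le.
Qed.

Lemma dual_normr0_eq0 f : dual_norm f = 0 -> f = 0.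
Proof.
move=> f0; apply/val_inj/funext => x; apply/eqP.
by rewrite -normr_le0 (le_trans (dual_norm_ub f x))// f0 mul0r.
Qed.

HB.instance Definition _ := Lmodule_isNormed.Build R[i] (dual E)
  dual_ler_normD dual_normrZ dual_normr0_eq0.

Lemma dual_complete (F : set_system (dual E)) :
  ProperFilter F -> cauchy F -> cvg F.
Proof.
move=> FF FC.
have w0 (x : E) : 0 <= `|x| by [].
have evw (f g : dual E) x : `|f x - g x| <= `|f - g| * `|x|.
  exact: (dual_norm_ub (f - g)).
have [l lP] := @cauchy_fun_limit R E (R[i])^o (dual E) (fun x => `|x|)
  (fun f => f) F (@complex_complete R) w0 evw FF FC.
have linl : linear l.
  move=> k x y; apply/eqP; rewrite -subr_eq0 -normr_le0.
  apply: le_eps => [//|//|e e0]; rewrite add0r.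
  pose W := `|k *: x + y| + `|k| * `|x| + `|y|.
  have W0 : 0 < W + 1 by rewrite ltr_wpDl// !addr_ge0// mulr_ge0.
  have [f hf] := filter_ex (lP _ (divr_gt0 e0 W0)).
  have -> : l (k *: x + y) - (k *: l x + l y) =
      (l (k *: x + y) - f (k *: x + y)) + k *: (f x - l x) + (f y - l y).
    rewrite dual_linear scalerBr -addrA [X in _ = _ + X]addrACA -opprD.
    by rewrite addrA subrK.
  apply: le_trans (_ : _ <= e / (W + 1) * W) _; last first.
    by rewrite mulrAC ler_pdivrMr// ler_pM2l// lerDl.
  rewrite /W !mulrDr; apply: le_trans (ler_normD _ _) _; apply: lerD => //.
  apply: le_trans (ler_normD _ _) _; apply: lerD; first by rewrite -normrN opprB; exact: hf.
  by rewrite normrZ mulrCA ler_wpM2l.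
  exact: hf.
have l0 : l \in @dual_pred R E.
  have [f hf] := filter_ex (lP _ ltr01).
  apply: (@dual_predP _ (dual_norm f + 1)) => // x.
  rewrite -[l x](subKr (f x)) mulrDl.
  by apply: le_trans (ler_normB _ _) _; rewrite lerD// dual_norm_ub.
apply/cvg_ex; exists (MkDual l0); apply/fcvgrPdist_lt => e e0.
have e2 : 0 < e / 2 by rewrite divr_gt0.
apply: filterS (lP _ e2) => f hf; apply: le_lt_trans (_ : _ <= e / 2) _.
  apply: dual_norm_le => [|x]; first exact: ltW.
  by have := hf x; rewrite distrC.
by rewrite ltr_pdivrMr// ltr_pMr// ltr1n.
Qed.

HB.instance Definition _ := Uniform_isComplete.Build (dual E) dual_complete.

End DualSpace.

(* The module actions are jointly bounded, with an arbitrary constant. *)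
HB.mixin Record isBanachBimodule (R : realType) (B : banachAlgType R) E
    & CompleteNormedModule R[i] E := {
  lact : B -> E -> E;
  ract : E -> B -> E;
  lactDl : forall a b x, lact (a + b) x = lact a x + lact b x;
  lactDr : forall a x y, lact a (x + y) = lact a x + lact a y;
  lactZl : forall (k : R[i]) a x, lact (k *: a) x = k *: lact a x;
  lactZr : forall (k : R[i]) a x, lact a (k *: x) = k *: lact a x;
  ractDl : forall x y a, ract (x + y) a = ract x a + ract y a;
  ractDr : forall x a b, ract x (a + b) = ract x a + ract x b;
  ractZl : forall (k : R[i]) x a, ract (k *: x) a = k *: ract x a;
  ractZr : forall (k : R[i]) x a, ract x (k *: a) = k *: ract x a;
  lactA : forall a b x, lact (bmul a b) x = lact a (lact b x);
  ractA : forall x a b, ract x (bmul a b) = ract (ract x a) b;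
  lractA : forall a x b, lact a (ract x b) = ract (lact a x) b;
  act_bounded : exists M : R[i],
    forall a x, `|lact a x| <= M * `|a| * `|x| /\
                `|ract x a| <= M * `|a| * `|x|
}.

#[short(type="banachBimodType")]
HB.structure Definition BanachBimodule (R : realType) (B : banachAlgType R) :=
  {E of isBanachBimodule R B E & CompleteNormedModule R[i] E}.

Section DualBimodule.
Variables (R : realType) (B : banachAlgType R) (E : banachBimodType B).
Implicit Types (a b : B) (f g : dual E).

Lemma act_bounded_ge0 : exists2 M : R[i], 0 <= M &
  forall a (x : E), `|lact a x| <= M * `|a| * `|x| /\
                    `|ract x a| <= M * `|a| * `|x|.
Proof.
have [M hM] := @act_bounded R B E.
have [M0|M0] := boolP (0 <= M); first by exists M.
have z (a : B) (x : E) : `|a| * `|x| = 0.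
  apply/eqP; apply: contraNT M0 => ax.
  have ax0 : 0 < `|a| * `|x| by rewrite lt_def ax mulr_ge0.
  rewrite -(pmulr_lge0 _ ax0) mulrA.
  by have [+ _] := hM a x; apply: le_trans.
exists 0 => // a x; have [] := hM a x.
by rewrite -!mulrA z !mulr0.
Qed.

Lemma dual_lact_subproof a f : (fun x : E => f (ract x a)) \in @dual_pred R E.
Proof.
have [M M0 hM] := act_bounded_ge0.
apply: (@dual_predP _ _ _ (`|f| * (M * `|a|))) => [k x y|x].
  by rewrite ractDl ractZl dual_linear.
apply: le_trans (dual_norm_ub f _) _; rewrite -mulrA.
apply: ler_wpM2l; first exact: (normr_ge0 f).
by have [] := hM a x.
Qed.

Lemma dual_ract_subproof f a : (fun x : E => f (lact a x)) \in @dual_pred R E.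
Proof.
have [M M0 hM] := act_bounded_ge0.
apply: (@dual_predP _ _ _ (`|f| * (M * `|a|))) => [k x y|x].
  by rewrite lactDr lactZr dual_linear.
apply: le_trans (dual_norm_ub f _) _; rewrite -mulrA.
apply: ler_wpM2l; first exact: (normr_ge0 f).
by have [] := hM a x.
Qed.

(* (a . f)(x) = f (x . a) and (f . a)(x) = f (a . x) *)
Definition dual_lact a f : dual E := MkDual (dual_lact_subproof a f).
Definition dual_ract f a : dual E := MkDual (dual_ract_subproof f a).

Let ext f g : (forall x, f x = g x) -> f = g.
Proof. by move=> fg; apply/val_inj/funext. Qed.

Lemma dual_lactDl a b f : dual_lact (a + b) f = dual_lact a f + dual_lact b f.
Proof. by apply: ext => x /=; rewrite ractDr linearD. Qed.
Lemma dual_lactDr a f g : dual_lact a (f + g) = dual_lact a f + dual_lact a g.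
Proof. exact: ext. Qed.
Lemma dual_lactZl (k : R[i]) a f : dual_lact (k *: a) f = k *: dual_lact a f.
Proof. by apply: ext => x /=; rewrite ractZr linearZ. Qed.
Lemma dual_lactZr (k : R[i]) a f : dual_lact a (k *: f) = k *: dual_lact a f.
Proof. exact: ext. Qed.
Lemma dual_ractDl f g a : dual_ract (f + g) a = dual_ract f a + dual_ract g a.
Proof. exact: ext. Qed.
Lemma dual_ractDr f a b : dual_ract f (a + b) = dual_ract f a + dual_ract f b.
Proof. by apply: ext => x /=; rewrite lactDl linearD. Qed.
Lemma dual_ractZl (k : R[i]) f a : dual_ract (k *: f) a = k *: dual_ract f a.
Proof. exact: ext. Qed.
Lemma dual_ractZr (k : R[i]) f a : dual_ract f (k *: a) = k *: dual_ract f a.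
Proof. by apply: ext => x /=; rewrite lactZl linearZ. Qed.
Lemma dual_lactA a b f : dual_lact (bmul a b) f = dual_lact a (dual_lact b f).
Proof. by apply: ext => x /=; rewrite ractA. Qed.
Lemma dual_ractA f a b : dual_ract f (bmul a b) = dual_ract (dual_ract f a) b.
Proof. by apply: ext => x /=; rewrite lactA. Qed.
Lemma dual_lractA a f b :
  dual_lact a (dual_ract f b) = dual_ract (dual_lact a f) b.
Proof. by apply: ext => x /=; rewrite lractA. Qed.

Lemma dual_act_bounded : exists M : R[i], forall a f,
  `|dual_lact a f| <= M * `|a| * `|f| /\ `|dual_ract f a| <= M * `|a| * `|f|.
Proof.
have [M M0 hM] := act_bounded_ge0; exists M => a f.
have M1 : 0 <= M * `|a| * `|f| by rewrite !mulr_ge0.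
split; apply: dual_norm_le => // x; apply: le_trans (dual_norm_ub f _) _.
  rewrite [leRHS]mulrAC [leRHS]mulrC.
  apply: ler_wpM2l; first exact: (normr_ge0 f).
  by have [] := hM a x.
rewrite [leRHS]mulrAC [leRHS]mulrC.
apply: ler_wpM2l; first exact: (normr_ge0 f).
by have [] := hM a x.
Qed.

HB.instance Definition _ := isBanachBimodule.Build R B (dual E)
  dual_lactDl dual_lactDr dual_lactZl dual_lactZr dual_ractDl dual_ractDr
  dual_ractZl dual_ractZr dual_lactA dual_ractA dual_lractA dual_act_bounded.

End DualBimodule.

(* [B] as a bimodule over itself; an alias, like [R^o] for rings, so that the
   bimodule structure is not inferred on every Banach algebra. *)
Definition regular_bimod (R : realType) (B : banachAlgType R) : Type := B.

Section RegularBimodule.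
Variables (R : realType) (B : banachAlgType R).

HB.instance Definition _ := CompleteNormedModule.on (regular_bimod B).

Let lact_ (a : B) (x : regular_bimod B) : regular_bimod B := bmul a (x : B).
Let ract_ (x : regular_bimod B) (a : B) : regular_bimod B := bmul (x : B) a.

Lemma regular_act_bounded : exists M : R[i], forall (a : B) (x : regular_bimod B),
  `|lact_ a x| <= M * `|a| * `|x| /\ `|ract_ x a| <= M * `|a| * `|x|.
Proof.
by exists 1 => a x; rewrite mul1r; split; last rewrite mulrC; exact: bnormM.
Qed.

HB.instance Definition _ := isBanachBimodule.Build R B (regular_bimod B)
  (fun a b x => bmulDl a b (x : B)) (fun a x y => bmulDr a (x : B) y)
  (fun k a x => esym (bscalerAl k a (x : B)))
  (fun k a x => esym (bscalerAr k a (x : B)))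
  (fun x y a => bmulDl (x : B) y a) (fun x a b => bmulDr (x : B) a b)
  (fun k x a => esym (bscalerAl k (x : B) a))
  (fun k x a => esym (bscalerAr k (x : B) a))
  (fun a b x => esym (bmulA a b (x : B))) (fun x a b => bmulA (x : B) a b)
  (fun a x b => bmulA a (x : B) b)
  regular_act_bounded.

End RegularBimodule.

Section Amenability.
Variables (R : realType) (B : banachAlgType R).

Definition derivation (E : banachBimodType B) (D : B -> E) :=
  forall a b, D (bmul a b) = ract (D a) b + lact a (D b).

Definition inner (E : banachBimodType B) (D : B -> E) :=
  exists z : E, forall a, D a = lact a z - ract z a.

Definition amenable :=
  forall (E : banachBimodType B) (D : {linear B -> dual E}),
    continuous D -> derivation D -> inner D.

Definition weakly_amenable :=
  forall D : {linear B -> dual (regular_bimod B)},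
    continuous D -> derivation D -> inner D.

(* Characters are not required to be continuous. *)
Definition character (phi : {linear B -> (R[i])^o}) :=
  (forall a b, phi (bmul a b) = phi a * phi b) /\ exists a, phi a != 0.

Definition point_derivation (phi d : {linear B -> (R[i])^o}) :=
  forall a b, d (bmul a b) = phi a * d b + phi b * d a.

(* 0-point amenability: [phi] ranges over the characters and the zero map. *)
Definition point_amenable0 :=
  forall phi : {linear B -> (R[i])^o}, character phi \/ (forall a, phi a = 0) ->
  forall d : {linear B -> (R[i])^o}, continuous d -> point_derivation phi d ->
  forall a, d a = 0.

End Amenability.

(* Main.v *)
From HB Require Import structures.
From Stdlib Require List.
Require Import Defs.
From mathcomp Require Import all_boot all_order all_algebra.
From mathcomp Require Import all_classical all_reals all_analysis.
From mathcomp Require Import complex ring.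

(**
The functions vanishing at infinity with values in [A] behave like a tensor
product of [C0 X] and [A], and the scalar factor is as amenable as possible, so
that only [A] matters.

One direction of each equivalence is soft. Evaluation at a point [x0] is a
contractive homomorphism from [C0 X A] to [A], and it is onto because [X] has a
continuous function vanishing at infinity which is one at [x0]. Each of the
three properties passes to such a quotient, the last one for commutative
algebras ([amenable_quotient], [point_amenable0_quotient],
[weakly_amenable_quotient]).

For the other direction, sums of elementary tensors [u (x) a] are dense, and [u]
may be taken to be a cutoff, a function with values in the unit interval, having
a local unit [p], that is [p u = u] ([tens_dense]). The scalar factor is
controlled by the group of continuous functions [w] of modulus one, acting
isometrically by multiplication: every cutoff is the half-sum of two of them
([cutoff_unimodular]), and the group is abelian.

- Amenability is equivalent to the existence of a virtual diagonal, a functional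
  on bounded bilinear forms ([amenable_virtual_diagonalP]). No unit is at hand;
  the differentials of [A] provide the module whose derivation yields the
  diagonal ([amenable_virtual_diagonal]), and conversely the identity that a
  diagonal produces in the bidual disposes of the inessential part of a module
  ([virtual_diagonal_inner]). A diagonal of [A] is then averaged over the
  unimodular group by an invariant mean, and passed to the limit along cutoffs
  tending to one ([C0_virtual_diagonal]).

- Let [d] be a point derivation of [C0 X A] at a character [phi]. Extended to
  multipliers, [phi] has modulus one at each [w]. The failure of [d] to be
  compatible with multiplication by [w] grows linearly along the powers of [w],
  being a derivation in [w], while it stays bounded; so it vanishes, and [d] on
  [u (x) a] becomes a point derivation of [A] at a character or at zero
  ([C0_character_derivation]). At [phi = 0] the factorisation of [u (x) a b]
  through the local unit does the same job ([C0_zero_derivation]).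

- For commutative [A], the same growth argument shows that a derivation [D] of
  [C0 X A] into its dual commutes with cutoffs. Then
  [a |-> D (p (x) a) (u (x) _)], with [p] a local unit of [u], is a derivation
  of [A] into its dual. It vanishes by weak amenability, and so does [D] by
  density ([C0_derivation0]).
*)

Set Implicit Arguments.
Unset Strict Implicit.
Unset Printing Implicit Defensive.

Import Order.TTheory GRing.Theory Num.Theory.
Import numFieldNormedType.Exports.
Local Open Scope classical_set_scope.
Local Open Scope ring_scope.

(** * Bounded linear and bilinear forms *)

Section Functionals.
Variable R : realType.

Lemma dual_ext (E : normedModType R[i]) (f g : dual E) :
  (forall x, f x = g x) -> f = g.
Proof. by move=> fg; apply/val_inj/funext. Qed.

Lemma dual_exists (E : normedModType R[i]) (f : E -> (R[i])^o) :
  linear f -> (exists M : R[i], forall x, `|f x| <= M * `|x|) ->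
  exists g : dual E, forall x, g x = f x.
Proof. by move=> lf [M fM]; exists (MkDual (dual_predP lf fM)). Qed.

Lemma bounded_of_continuous (E F : normedModType R[i]) (f : {linear E -> F}) :
  continuous f -> exists2 M : R[i], 0 <= M & forall x, `|f x| <= M * `|x|.
Proof.
move=> /linear_bounded_continuous/linear_boundedP/pinfty_ex_gt0[M M0 fM].
by exists M => //; exact: ltW.
Qed.

Lemma continuous_of_bounded (E F : normedModType R[i]) (f : {linear E -> F})
    (M : R[i]) :
  (forall x, `|f x| <= M * `|x|) -> continuous f.
Proof.
move=> fM; apply: bounded_linear_continuous; apply/ex_bound; exists `|M|.
apply/nbhs_norm0P; exists 1 => //= x /= x1; apply: le_trans (fM x) _.
have [->|x0] := eqVneq x 0; first by rewrite normr0 mulr0.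
have M0 : 0 <= M.
  by rewrite -(pmulr_lge0 _ (_ : 0 < `|x|)) ?normr_gt0// (le_trans _ (fM x)).
by rewrite ger0_norm// ler_piMr// ltW.
Qed.

Lemma dual_of_continuous (E : normedModType R[i])
    (f : {linear E -> (R[i])^o}) : continuous f ->
  exists g : dual E, forall x, g x = f x.
Proof.
move=> cf; have [K K0 fK] := bounded_of_continuous cf.
by apply: dual_exists; [exact: linearP|exists K].
Qed.

Lemma dual_app0 (E : normedModType R[i]) (f : dual E) : f 0 = 0.
Proof. exact: linear0. Qed.

Lemma dual_appD (E : normedModType R[i]) (f : dual E) x y :
  f (x + y) = f x + f y.
Proof. exact: linearD. Qed.

Lemma dual_appB (E : normedModType R[i]) (f : dual E) x y :
  f (x - y) = f x - f y.
Proof. exact: linearB. Qed.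

Lemma dual_appZ (E : normedModType R[i]) (f : dual E) (k : R[i]) x :
  f (k *: x) = k *: f x.
Proof. exact: linearZ. Qed.

Lemma lt_some_nat (K : R[i]) : 0 <= K -> exists n : nat, K < n.+1%:R.
Proof.
move=> K0; exists (Num.bound (complex.Re K)).
have K0' : 0 <= complex.Re K by rewrite -ler0c -ge0_ReE.
rewrite [ltLHS](ge0_ReE K0) -(rmorph_nat (real_complex R)) ltcR.
by apply: lt_le_trans (archi_boundP K0') _; rewrite ler_nat.
Qed.

End Functionals.

Definition bil_pred (R : realType) (E F : normedModType R[i])
    : {pred E -> F -> (R[i])^o} :=
  fun f => `[< [/\ forall y, linear (f^~ y), forall x, linear (f x) &
    exists2 M : R[i], 0 <= M & forall x y, `|f x y| <= M * (`|x| * `|y|)] >].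

Record bil (R : realType) (E F : normedModType R[i]) := MkBil {
  bil_fun :> E -> F -> (R[i])^o;
  bil_funP : bil_fun \in @bil_pred R E F
}.

Section BilSpace.
Variables (R : realType) (E F : normedModType R[i]).
Local Open Scope complex_scope.

HB.instance Definition _ := [isSub for @bil_fun R E F].
HB.instance Definition _ := [Choice of bil E F by <:].

Lemma bil_submod_closed : submod_closed (@bil_pred R E F).
Proof.
split=> [|k f g].
  apply/asboolP; split=> [y|x|]; try by move=> c u v; rewrite /= scaler0 addr0.
  by exists 0 => // x y; rewrite normr0 mul0r.
move=> /asboolP[fl fr [M M0 fM]] /asboolP[gl gr [N N0 gN]].
apply/asboolP; split=> [y c u v|x c u v|].
- rewrite /= !fctE fl gl !scalerDr addrACA.
  by rewrite !scalerA [k * c]mulrC.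
- rewrite /= !fctE fr gr !scalerDr addrACA.
  by rewrite !scalerA [k * c]mulrC.
- exists (`|k| * M + N) => [|x y]; first by rewrite addr_ge0 ?mulr_ge0.
  rewrite mulrDl (le_trans (ler_normD _ _))// lerD//.
  by rewrite normrZ -mulrA ler_wpM2l.
Qed.

HB.instance Definition _ := GRing.isSubmodClosed.Build R[i]
  (E -> F -> (R[i])^o) (@bil_pred R E F) bil_submod_closed.
HB.instance Definition _ := [SubChoice_isSubLmodule of bil E F by <:].

Implicit Types f g : bil E F.

Lemma bil_ext f g : (forall x y, f x y = g x y) -> f = g.
Proof.
by move=> fg; apply/val_inj/funext => x; apply/funext => y; exact: fg.
Qed.

Lemma bil_linearl f y : linear (f^~ y).
Proof. by have /asboolP[] := bil_funP f. Qed.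

Lemma bil_linearr f x : linear (f x).
Proof. by have /asboolP[] := bil_funP f. Qed.

Lemma bilDl f x x' y : f (x + x') y = f x y + f x' y.
Proof. by have := bil_linearl f y 1 x x'; rewrite !scale1r. Qed.

Lemma bilDr f x y y' : f x (y + y') = f x y + f x y'.
Proof. by have := bil_linearr f x 1 y y'; rewrite !scale1r. Qed.

Lemma bil0l f y : f 0 y = 0.
Proof. by apply: (addrI (f 0 y)); rewrite -bilDl !addr0. Qed.

Lemma bil0r f x : f x 0 = 0.
Proof. by apply: (addrI (f x 0)); rewrite -bilDr !addr0. Qed.

Lemma bilZl f (k : R[i]) x y : f (k *: x) y = k *: f x y.
Proof. by have := bil_linearl f y k x 0; rewrite !addr0 bil0l addr0. Qed.

Lemma bilZr f (k : R[i]) x y : f x (k *: y) = k *: f x y.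
Proof. by have := bil_linearr f x k y 0; rewrite !addr0 bil0r addr0. Qed.

Lemma bil_bounded f : exists2 M : R[i], 0 <= M &
  forall x y, `|f x y| <= M * (`|x| * `|y|).
Proof. by have /asboolP[] := bil_funP f. Qed.

Lemma bil_exists (f : E -> F -> (R[i])^o) :
  (forall y, linear (f^~ y)) -> (forall x, linear (f x)) ->
  (exists2 M : R[i], 0 <= M & forall x y, `|f x y| <= M * (`|x| * `|y|)) ->
  exists g : bil E F, forall x y, g x y = f x y.
Proof.
move=> fl fr fM; have fP : f \in @bil_pred R E F by apply/asboolP.
by exists (MkBil fP).
Qed.

Definition bil_norm f : R[i] :=
  (supnorm [set z : E * F | `|z.1| <= 1 /\ `|z.2| <= 1] (fun z => f z.1 z.2))%:C.

Lemma bil_norm_ub f x y : `|f x y| <= bil_norm f * (`|x| * `|y|).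
Proof.
have [M M0 fM] := bil_bounded f.
have [->|x0] := eqVneq x 0; first by rewrite bil0l !normr0 mul0r mulr0.
have [->|y0] := eqVneq y 0; first by rewrite bil0r !normr0 !mulr0.
have nx0 : 0 < `|x| by rewrite normr_gt0.
have ny0 : 0 < `|y| by rewrite normr_gt0.
rewrite -[x in f x](scalerKV (lt0r_neq0 nx0)) bilZl.
rewrite -[y in f _ y](scalerKV (lt0r_neq0 ny0)) bilZr.
rewrite !normrZ !normr_id mulrA mulrC ler_wpM2r ?mulr_ge0//.
pose z := (`|x|^-1 *: x, `|y|^-1 *: y).
have z1 : `|z.1| <= 1 /\ `|z.2| <= 1.
  by rewrite !normrZ !gtr0_norm ?invr_gt0// !mulVf ?gt_eqF.
apply: (@supnorm_ub _ _ _ _ (fun z => f z.1 z.2) M z) => //.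
move=> [u v] /= [u1 v1]; apply: le_trans (fM u v) _.
by rewrite ler_piMr// mulr_ile1.
Qed.

Lemma bil_norm_le f M : 0 <= M ->
  (forall x y, `|f x y| <= M * (`|x| * `|y|)) -> bil_norm f <= M.
Proof.
move=> M0 fM; apply: supnorm_le => // -[x y] /= [x1 y1].
by apply: le_trans (fM x y) _; rewrite ler_piMr// mulr_ile1.
Qed.

Lemma bil_ler_normD f g : bil_norm (f + g) <= bil_norm f + bil_norm g.
Proof.
apply: bil_norm_le => [|x y]; first by rewrite addr_ge0 ?supnorm_ge0.
rewrite -[X in `|X| <= _]/((f x y : (R[i])^o) + g x y) mulrDl.
by rewrite (le_trans (ler_normD _ _))// lerD// bil_norm_ub.
Qed.

Lemma bil_normrZ (k : R[i]) f : bil_norm (k *: f) = `|k| * bil_norm f.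
Proof.
have le c h : bil_norm (c *: h) <= `|c| * bil_norm h.
  apply: bil_norm_le => [|x y]; first by rewrite mulr_ge0 ?supnorm_ge0.
  rewrite -[X in `|X| <= _]/(c *: (h x y : (R[i])^o)) normrZ -mulrA.
  by rewrite ler_wpM2l// bil_norm_ub.
apply/eqP; rewrite eq_le le /=; have [->|k0] := eqVneq k 0.
  by rewrite normr0 mul0r supnorm_ge0.
rewrite -ler_pdivlMl ?normr_gt0// -normfV.
by rewrite -[X in bil_norm X <= _](scalerK k0) le.
Qed.

Lemma bil_normr0_eq0 f : bil_norm f = 0 -> f = 0.
Proof.
move=> f0; apply/bil_ext => x y; apply/eqP.
by rewrite -normr_le0 (le_trans (bil_norm_ub f x y))// f0 mul0r.
Qed.

HB.instance Definition _ := Lmodule_isNormed.Build R[i] (bil E F)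
  bil_ler_normD bil_normrZ bil_normr0_eq0.

Lemma bil_complete (G : set_system (bil E F)) :
  ProperFilter G -> cauchy G -> cvg G.
Proof.
move=> FG GC.
have w0 (z : E * F) : 0 <= `|z.1| * `|z.2| by rewrite mulr_ge0.
have evw (f g : bil E F) (z : E * F) :
    `|f z.1 z.2 - g z.1 z.2| <= `|f - g| * (`|z.1| * `|z.2|).
  exact: (bil_norm_ub (f - g)).
have [l lP] := @cauchy_fun_limit R (E * F) (R[i])^o (bil E F)
  (fun z => `|z.1| * `|z.2|) (fun f z => f z.1 z.2) G (@complex_complete R)
  w0 evw FG GC.
(* Linearity in one variable passes to the limit: the defect of linearity of
   [l] is bounded by [e] times a fixed weight, for every [e]. *)
have lin_limit (V : normedModType R[i]) (h : V -> E * F) (c : R[i]) :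
    0 <= c -> (forall x, `|(h x).1| * `|(h x).2| <= c * `|x|) ->
    (forall f : bil E F, linear (fun x => f (h x).1 (h x).2)) ->
    linear (fun x => l (h x)).
  move=> c0 hc hl k x y; apply/eqP; rewrite -subr_eq0 -normr_le0.
  apply: le_eps => [//|//|e e0]; rewrite add0r.
  pose W := c * `|k *: x + y| + `|k| * (c * `|x|) + c * `|y|.
  have W0 : 0 < W + 1 by rewrite ltr_wpDl// !addr_ge0// !mulr_ge0.
  have [f hf] := filter_ex (lP _ (divr_gt0 e0 W0)).
  have hf' z : `|f (h z).1 (h z).2 - l (h z)| <= e / (W + 1) * (c * `|z|).
    apply: le_trans (hf _) _; apply: ler_wpM2l (hc z).
    by rewrite divr_ge0// ltW.
  have -> : l (h (k *: x + y)) - (k *: l (h x) + l (h y)) =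
      (l (h (k *: x + y)) - f (h (k *: x + y)).1 (h (k *: x + y)).2) +
      k *: (f (h x).1 (h x).2 - l (h x)) + (f (h y).1 (h y).2 - l (h y)).
    rewrite hl scalerBr -addrA [X in _ = _ + X]addrACA -opprD.
    by rewrite addrA subrK.
  apply: le_trans (_ : _ <= e / (W + 1) * W) _; last first.
    by rewrite mulrAC ler_pdivrMr// ler_pM2l// lerDl.
  rewrite /W !mulrDr; apply: le_trans (ler_normD _ _) _; apply: lerD; last exact: hf'.
  apply: le_trans (ler_normD _ _) _; apply: lerD.
    by rewrite -normrN opprB; exact: hf'.
  by rewrite normrZ mulrCA ler_wpM2l.
have l0 : (fun x y => l (x, y)) \in @bil_pred R E F.
  apply/asboolP; split=> [y|x|].
  - apply: (lin_limit E (fun x => (x, y)) `|y|) => // [x|f].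
      by rewrite mulrC.
    exact: bil_linearl.
  - apply: (lin_limit F (fun y => (x, y)) `|x|) => // f.
    exact: bil_linearr.
  - have [f hf] := filter_ex (lP _ ltr01).
    exists (bil_norm f + 1) => [|x y]; first by rewrite addr_ge0 ?supnorm_ge0.
    rewrite -[l (x, y)](subKr (f x y)) mulrDl.
    apply: le_trans (ler_normB _ _) _; rewrite lerD ?bil_norm_ub//.
    exact: (hf (x, y)).
apply/cvg_ex; exists (MkBil l0); apply/fcvgrPdist_lt => e e0.
have e2 : 0 < e / 2 by rewrite divr_gt0.
apply: filterS (lP _ e2) => f hf; apply: le_lt_trans (_ : _ <= e / 2) _.
  apply: bil_norm_le => [|x y]; first exact: ltW.
  by have := hf (x, y); rewrite distrC.
by rewrite ltr_pdivrMr// ltr_pMr// ltr1n.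
Qed.

HB.instance Definition _ := Uniform_isComplete.Build (bil E F) bil_complete.

End BilSpace.

(** * Auxiliary bimodules *)

(** Making one of the two actions trivial turns the canonical map into the
    bidual into a derivation; amenability then yields one-sided identities. *)
Definition left_only (R : realType) (B : banachAlgType R)
  (E : banachBimodType B) : Type := E.
Definition right_only (R : realType) (B : banachAlgType R)
  (E : banachBimodType B) : Type := E.

Section OneSided.
Variables (R : realType) (B : banachAlgType R) (E : banachBimodType B).

HB.instance Definition _ := CompleteNormedModule.on (left_only E).
HB.instance Definition _ := CompleteNormedModule.on (right_only E).

Let zl (a : B) (x : E) : E := 0.
Let zr (x : E) (a : B) : E := 0.

Let zlDl a b x : zl (a + b) x = zl a x + zl b x. Proof. by rewrite /zl addr0. Qed.
Let zlDr a x y : zl a (x + y) = zl a x + zl a y. Proof. by rewrite /zl addr0. Qed.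
Let zlZl (k : R[i]) a x : zl (k *: a) x = k *: zl a x.
Proof. by rewrite /zl scaler0. Qed.
Let zlZr (k : R[i]) a x : zl a (k *: x) = k *: zl a x.
Proof. by rewrite /zl scaler0. Qed.
Let zrDl x y a : zr (x + y) a = zr x a + zr y a. Proof. by rewrite /zr addr0. Qed.
Let zrDr x a b : zr x (a + b) = zr x a + zr x b. Proof. by rewrite /zr addr0. Qed.
Let zrZl (k : R[i]) x a : zr (k *: x) a = k *: zr x a.
Proof. by rewrite /zr scaler0. Qed.
Let zrZr (k : R[i]) x a : zr x (k *: a) = k *: zr x a.
Proof. by rewrite /zr scaler0. Qed.
Let zlA a b x : zl (bmul a b) x = zl a (zl b x). Proof. by []. Qed.
Let zrA x a b : zr x (bmul a b) = zr (zr x a) b. Proof. by []. Qed.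

Let lzA a x b : lact a (zr x b) = zr (lact a x) b.
Proof. by rewrite /zr; apply: (addrI (lact a 0)); rewrite -lactDr !addr0. Qed.
Let zrlA a x b : zl a (ract x b) = ract (zl a x) b.
Proof. by rewrite /zl; apply: (addrI (ract 0 b)); rewrite -ractDl !addr0. Qed.

Let left_bounded : exists M : R[i], forall a x,
  `|lact a x| <= M * `|a| * `|x :> E| /\ `|zr x a| <= M * `|a| * `|x|.
Proof.
have [M M0 hM] := act_bounded_ge0 E; exists M => a x.
by split; [have [] := hM a x|rewrite normr0 !mulr_ge0].
Qed.

Let right_bounded : exists M : R[i], forall a x,
  `|zl a x| <= M * `|a| * `|x| /\ `|ract x a| <= M * `|a| * `|x :> E|.
Proof.
have [M M0 hM] := act_bounded_ge0 E; exists M => a x.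
by split; [rewrite normr0 !mulr_ge0|have [] := hM a x].
Qed.

HB.instance Definition _ := isBanachBimodule.Build R B (left_only E)
  (@lactDl R B E) (@lactDr R B E) (@lactZl R B E) (@lactZr R B E)
  zrDl zrDr zrZl zrZr (@lactA R B E) zrA lzA left_bounded.

HB.instance Definition _ := isBanachBimodule.Build R B (right_only E)
  zlDl zlDr zlZl zlZr (@ractDl R B E) (@ractDr R B E) (@ractZl R B E)
  (@ractZr R B E) zlA (@ractA R B E) zrlA right_bounded.

End OneSided.

(** The bounded bilinear forms on [A], seen as functionals on the bimodule of
    universal differentials of [A]: [f b a] is the value of [f] at [b da]. The
    identity [(b da) c = b d(ac) - ba dc] explains the left action. *)
Definition diff_bimod (R : realType) (A : banachAlgType R) : Type := bil A A.

Section DiffBimodule.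
Variables (R : realType) (A : banachAlgType R).
Implicit Types (a b c : A) (f g : bil A A).

HB.instance Definition _ := CompleteNormedModule.on (diff_bimod A).

Lemma diff_lact_subproof c f :
  (fun b a => f b (bmul a c) - f (bmul b a) c) \in @bil_pred R A A.
Proof.
apply/asboolP; split=> [a k x y|b k x y|].
- rewrite bmulDl -bscalerAl !bilDl !bilZl opprD addrACA.
  by rewrite scalerBr.
- rewrite bmulDl bmulDr -bscalerAl -bscalerAr !bilDl !bilDr !bilZl !bilZr.
  by rewrite opprD addrACA scalerBr.
- exists (2 * `|f| * `|c|) => [|b a]; first by rewrite !mulr_ge0.
  apply: le_trans (ler_normB _ _) _.
  rewrite -[2 * _ * _]mulrA -[2 * _ * _]mulrA mulr_natl mulr2n lerD//.
    apply: le_trans (bil_norm_ub f _ _) _; rewrite -mulrA.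
    rewrite ler_wpM2l ?(normr_ge0 f)// mulrCA ler_wpM2l//.
    by rewrite mulrC bnormM.
  apply: le_trans (bil_norm_ub f _ _) _; rewrite -mulrA.
  by rewrite ler_wpM2l ?(normr_ge0 f)// mulrC ler_wpM2l// bnormM.
Qed.

Lemma diff_ract_subproof f c : (fun b a => f (bmul c b) a) \in @bil_pred R A A.
Proof.
apply/asboolP; split=> [a k x y|b k x y|].
- by rewrite bmulDr -bscalerAr bilDl bilZl.
- by rewrite bilDr bilZr.
- exists (`|f| * `|c|) => [|b a]; first by rewrite !mulr_ge0.
  apply: le_trans (bil_norm_ub f _ _) _; rewrite -mulrA.
  by rewrite ler_wpM2l ?(normr_ge0 f)// mulrA ler_wpM2r// bnormM.
Qed.

Definition diff_lact c (f : diff_bimod A) : diff_bimod A :=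
  MkBil (diff_lact_subproof c f).
Definition diff_ract (f : diff_bimod A) c : diff_bimod A :=
  MkBil (diff_ract_subproof f c).

Implicit Types u v : diff_bimod A.

Lemma diff_lactDl a b u : diff_lact (a + b) u = diff_lact a u + diff_lact b u.
Proof.
by apply: bil_ext => x y /=; rewrite bmulDr !bilDr opprD addrACA.
Qed.
Lemma diff_lactDr a u v : diff_lact a (u + v) = diff_lact a u + diff_lact a v.
Proof. by apply: bil_ext => x y /=; rewrite [LHS]/= opprD addrACA. Qed.
Lemma diff_lactZl (k : R[i]) a u : diff_lact (k *: a) u = k *: diff_lact a u.
Proof.
by apply: bil_ext => x y /=; rewrite -bscalerAr !bilZr -scalerBr.
Qed.
Lemma diff_lactZr (k : R[i]) a u : diff_lact a (k *: u) = k *: diff_lact a u.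
Proof. by apply: bil_ext => x y; rewrite [RHS]scalerBr. Qed.
Lemma diff_ractDl u v a : diff_ract (u + v) a = diff_ract u a + diff_ract v a.
Proof. exact: bil_ext. Qed.
Lemma diff_ractDr u a b : diff_ract u (a + b) = diff_ract u a + diff_ract u b.
Proof. by apply: bil_ext => x y /=; rewrite bmulDl bilDl. Qed.
Lemma diff_ractZl (k : R[i]) u a : diff_ract (k *: u) a = k *: diff_ract u a.
Proof. exact: bil_ext. Qed.
Lemma diff_ractZr (k : R[i]) u a : diff_ract u (k *: a) = k *: diff_ract u a.
Proof. by apply: bil_ext => x y /=; rewrite -bscalerAl bilZl. Qed.
Lemma diff_lactA a b u : diff_lact (bmul a b) u = diff_lact a (diff_lact b u).
Proof.
by apply: bil_ext => x y /=; rewrite !bmulA opprB addrA subrK.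
Qed.
Lemma diff_ractA u a b : diff_ract u (bmul a b) = diff_ract (diff_ract u a) b.
Proof. by apply: bil_ext => x y /=; rewrite bmulA. Qed.
Lemma diff_lractA a u b :
  diff_lact a (diff_ract u b) = diff_ract (diff_lact a u) b.
Proof. by apply: bil_ext => x y /=; rewrite bmulA. Qed.

Lemma diff_act_bounded : exists M : R[i], forall a u,
  `|diff_lact a u| <= M * `|a| * `|u| /\ `|diff_ract u a| <= M * `|a| * `|u|.
Proof.
exists 2 => a u.
split; (apply: bil_norm_le => [|x y]; first by rewrite !mulr_ge0).
- apply: le_trans (ler_normB _ _) _.
  rewrite -[2 * _ * _]mulrA -[2 * _ * _]mulrA mulr_natl mulr2n lerD//.
    apply: le_trans (bil_norm_ub u _ _) _; rewrite [_ * `|u|]mulrC -mulrA.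
    rewrite ler_wpM2l ?(normr_ge0 u)// mulrCA ler_wpM2l//.
    by rewrite mulrC bnormM.
  apply: le_trans (bil_norm_ub u _ _) _; rewrite [_ * `|u|]mulrC -mulrA.
  by rewrite ler_wpM2l ?(normr_ge0 u)// mulrC ler_wpM2l// bnormM.
- apply: le_trans (bil_norm_ub u _ _) _; rewrite [_ * `|u|]mulrC -mulrA.
  rewrite ler_wpM2l ?(normr_ge0 u)// mulrA ler_wpM2r//.
  by apply: le_trans (bnormM _ _) _; rewrite ler_wpM2r// ler_peMl// ler1n.
Qed.

HB.instance Definition _ := isBanachBimodule.Build R A (diff_bimod A)
  diff_lactDl diff_lactDr diff_lactZl diff_lactZr diff_ractDl diff_ractDr
  diff_ractZl diff_ractZr diff_lactA diff_ractA diff_lractA diff_act_bounded.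

End DiffBimodule.

(** Restriction of scalars along a contractive homomorphism [h : B -> A]. *)
Definition pullback_bimod (R : realType) (B A : banachAlgType R)
  (h : {linear B -> A}) (hM : forall a b, h (bmul a b) = bmul (h a) (h b))
  (h1 : forall b, `|h b| <= `|b|) (E : banachBimodType A) : Type := E.

Section Pullback.
Variables (R : realType) (B A : banachAlgType R) (h : {linear B -> A}).
Variables (hM : forall a b, h (bmul a b) = bmul (h a) (h b)).
Variables (h1 : forall b, `|h b| <= `|b|) (E : banachBimodType A).
Local Notation P := (pullback_bimod hM h1 E).

HB.instance Definition _ := CompleteNormedModule.on P.

Let pl (b : B) (x : P) : P := lact (h b) (x : E).
Let pr (x : P) (b : B) : P := ract (x : E) (h b).

Let plDl a b x : pl (a + b) x = pl a x + pl b x.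
Proof. by rewrite /pl linearD lactDl. Qed.
Let plDr a x y : pl a (x + y) = pl a x + pl a y. Proof. exact: lactDr. Qed.
Let plZl (k : R[i]) a x : pl (k *: a) x = k *: pl a x.
Proof. by rewrite /pl linearZ lactZl. Qed.
Let plZr (k : R[i]) a x : pl a (k *: x) = k *: pl a x. Proof. exact: lactZr. Qed.
Let prDl x y a : pr (x + y) a = pr x a + pr y a. Proof. exact: ractDl. Qed.
Let prDr x a b : pr x (a + b) = pr x a + pr x b.
Proof. by rewrite /pr linearD ractDr. Qed.
Let prZl (k : R[i]) x a : pr (k *: x) a = k *: pr x a. Proof. exact: ractZl. Qed.
Let prZr (k : R[i]) x a : pr x (k *: a) = k *: pr x a.
Proof. by rewrite /pr linearZ ractZr. Qed.
Let plA a b x : pl (bmul a b) x = pl a (pl b x).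
Proof. by rewrite /pl hM lactA. Qed.
Let prA x a b : pr x (bmul a b) = pr (pr x a) b.
Proof. by rewrite /pr hM ractA. Qed.
Let plrA a x b : pl a (pr x b) = pr (pl a x) b. Proof. exact: lractA. Qed.

Let pbounded : exists M : R[i], forall a x,
  `|pl a x| <= M * `|a| * `|x| /\ `|pr x a| <= M * `|a| * `|x|.
Proof.
have [M M0 hM'] := act_bounded_ge0 E; exists M => a x.
have le : M * `|h a| * `|x| <= M * `|a| * `|x| by rewrite ler_wpM2r// ler_wpM2l.
by split; apply: le_trans le; have [] := hM' (h a) x.
Qed.

HB.instance Definition _ := isBanachBimodule.Build R B P
  plDl plDr plZl plZr prDl prDr prZl prZr plA prA plrA pbounded.

End Pullback.

(** * Amenability and virtual diagonals *)

(** A virtual diagonal, an element of the bidual of the projective tensor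
    square, is represented by its action on bounded bilinear forms. *)
Definition virtual_diagonal (R : realType) (A : banachAlgType R)
    (M : dual (bil A A)) :=
  (forall c (f f1 f2 : bil A A), (forall b a, f1 b a = f (bmul c b) a) ->
     (forall b a, f2 b a = f b (bmul a c)) -> M f1 = M f2) /\
  (forall c (psi : dual A) (f : bil A A),
     (forall b a, f b a = psi (bmul c (bmul b a))) -> M f = psi c).

Section AmenableVirtualDiagonal.
Variables (R : realType) (A : banachAlgType R).
Hypothesis amA : amenable A.

Lemma amenable_inner (E : banachBimodType A) (D : A -> dual E) (K : R[i]) :
  linear D -> (forall a, `|D a| <= K * `|a|) -> derivation D -> inner D.
Proof.
move=> lD DK dD; pose lD' := GRing.isLinear.Build R[i] A (dual E) _ D lD.
pose D' : {linear A -> dual E} := HB.pack D lD'.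
exact: (amA (D := D') (continuous_of_bounded (f := D') DK) dD).
Qed.


Lemma bidual_subproof (E : normedModType R[i]) (x : E) :
  (fun f : dual E => f x) \in @dual_pred R (dual E).
Proof.
apply: (@dual_predP _ _ _ `|x|) => // f.
by rewrite mulrC; exact: dual_norm_ub.
Qed.

Definition bidual (E : normedModType R[i]) (x : E) : dual (dual E) :=
  MkDual (bidual_subproof x).

Lemma bidual_linear (E : normedModType R[i]) : linear (@bidual E).
Proof. by move=> k x y; apply: dual_ext => f; rewrite /= dual_linear. Qed.

Lemma bidual_norm (E : normedModType R[i]) (x : E) : `|bidual x| <= `|x|.
Proof.
by apply: dual_norm_le => // f; rewrite mulrC; exact: dual_norm_ub.
Qed.

(** Over a module with trivial left action, the embedding of [A] into the bidual
    of [A] is a derivation; the element implementing it is a one-sided identity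
    for the action of [A]. The next lemma is the mirror image. *)
Lemma amenable_left_unit : exists L : dual (dual A),
  forall c (psi f : dual A), (forall b, f b = psi (bmul c b)) -> L f = psi c.
Proof.
pose E : banachBimodType A := right_only (dual (regular_bimod A)).
have [|||L LE] := @amenable_inner E (@bidual (regular_bimod A)) 1.
- exact: bidual_linear.
- by move=> a; rewrite mul1r; exact: bidual_norm.
- move=> a b; apply: dual_ext => f /=.
  by rewrite [X in X + _](_ : _ = 0) ?add0r.
exists L => c psi f fE.
have -> : f = ract (psi : E) c by apply: dual_ext => b; rewrite fE.
have -> : psi c = L (ract (psi : E) c) - L (lact c (psi : E)).
  exact: (congr1 (fun g : dual (dual A) => g psi) (LE c)).
by rewrite [X in _ - X]linear0 subr0.
Qed.

Lemma amenable_right_unit : exists L : dual (dual A),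
  forall c (psi f : dual A), (forall b, f b = psi (bmul b c)) -> L f = psi c.
Proof.
pose E : banachBimodType A := left_only (dual (regular_bimod A)).
have [|||L LE] := @amenable_inner E (fun a => - @bidual (regular_bimod A) a) 1.
- by move=> k x y /=; rewrite bidual_linear opprD scalerN.
- by move=> a; rewrite mul1r normrN; exact: bidual_norm.
- move=> a b; apply: dual_ext => f /=.
  rewrite [X in _ + X](_ : _ = 0) ?addr0 //.
  by apply/funext => x; exact: oppr0.
exists L => c psi f fE.
have -> : f = lact c (psi : E) by apply: dual_ext => b; rewrite fE.
have /eqP : - psi c = L (ract (psi : E) c) - L (lact c (psi : E)).
  exact: (congr1 (fun g : dual (dual A) => g psi) (LE c)).
by rewrite [X in X - _]linear0 sub0r eqr_opp => /eqP.
Qed.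

(** Composing the one-sided identities in the manner of [r + l - r * l] gives a
    two-sided one. *)
Lemma amenable_unit : exists L : dual (dual A),
  (forall c (psi f : dual A), (forall b, f b = psi (bmul c b)) -> L f = psi c) /\
  (forall c (psi f : dual A), (forall b, f b = psi (bmul b c)) -> L f = psi c).
Proof.
have [l lE] := amenable_left_unit; have [r rE] := amenable_right_unit.
pose B := regular_bimod A.
(* [psi |-> r (in_r psi)] is the product of [r] and [l] in the bidual. *)
pose in_l (psi : dual A) (b : A) : dual A := dual_lact (E := B) b psi.
have in_r_subproof (psi : dual A) : (fun b => l (in_l psi b)) \in @dual_pred R A.
  apply: (@dual_predP _ _ _ (`|l| * `|psi|)) => [k x y|x].
    by rewrite /in_l dual_lactDl dual_lactZl dual_linear.
  apply: le_trans (dual_norm_ub l _) _; rewrite -mulrA.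
  rewrite ler_wpM2l ?(normr_ge0 l)//; apply: dual_norm_le => [|y].
    by rewrite mulr_ge0.
  apply: le_trans (dual_norm_ub psi _) _; rewrite -mulrA.
  by rewrite ler_wpM2l ?(normr_ge0 psi)// mulrC bnormM.
pose in_r psi : dual A := MkDual (in_r_subproof psi).
have in_r_le psi : `|in_r psi| <= `|l| * `|psi|.
  apply: dual_norm_le => [|x]; first by rewrite mulr_ge0.
  rewrite /= -mulrA; apply: le_trans (dual_norm_ub l _) _.
  rewrite ler_wpM2l ?(normr_ge0 l)//; apply: dual_norm_le => [|y].
    by rewrite mulr_ge0.
  apply: le_trans (dual_norm_ub psi _) _; rewrite -mulrA.
  by rewrite ler_wpM2l ?(normr_ge0 psi)// mulrC bnormM.
have in_r_lin : linear in_r.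
  move=> k f g; apply: dual_ext => b /=.
  by rewrite /in_l dual_lactDr dual_lactZr dual_linear.
have [||L LE] := @dual_exists R (dual A) (fun psi => r psi + l psi - r (in_r psi)).
- move=> k f g; rewrite in_r_lin !dual_linear scalerBr scalerDr opprD.
  by rewrite [X in X + _ = _]addrACA [LHS]addrACA.
- exists (`|r| + `|l| + `|r| * `|l|) => f.
  rewrite !mulrDl (le_trans (ler_normB _ _))// lerD//.
    by rewrite (le_trans (ler_normD _ _))// lerD// dual_norm_ub.
  apply: le_trans (dual_norm_ub r _) _; rewrite -mulrA.
  by rewrite ler_wpM2l ?(normr_ge0 r).
exists L; split=> c psi f fE; rewrite LE.
- have -> : in_r f = f.
    apply: dual_ext => b.
    have -> : in_r f b = in_l psi b c.
      by apply: (lE c (in_l psi b)) => b'; rewrite /in_l /= fE bmulA.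
    by rewrite fE.
  by rewrite [r f + _]addrC addrK; exact: (lE c psi).
- have -> : r (in_r f) = in_r psi c.
    apply: rE => b; rewrite /=; congr (dual_fun l _).
    apply: dual_ext => b'; rewrite /= fE.
    by rewrite -[RHS]/(psi (bmul b' (bmul b c))) bmulA.
  have -> : in_r psi c = l f.
    by rewrite /=; congr (dual_fun l _); apply: dual_ext => b; rewrite fE.
  by rewrite addrK; exact: (rE c psi).
Qed.

Lemma bil_col_subproof (f : bil A A) (a : A) : f^~ a \in @dual_pred R A.
Proof.
apply: (@dual_predP _ _ _ (`|f| * `|a|)) => [k x y|x].
  by rewrite bilDl bilZl.
by rewrite -mulrA [`|a| * _]mulrC; exact: bil_norm_ub.
Qed.

Definition bil_col f a : dual A := MkDual (bil_col_subproof f a).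

Lemma bil_row_subproof (f : bil A A) (b : A) : f b \in @dual_pred R A.
Proof.
apply: (@dual_predP _ _ _ (`|f| * `|b|)) => [k x y|x].
  by rewrite bilDr bilZr.
by rewrite -mulrA; exact: bil_norm_ub.
Qed.

Definition bil_row f b : dual A := MkDual (bil_row_subproof f b).

Lemma bil_col_norm f a : `|bil_col f a| <= `|f| * `|a|.
Proof.
apply: dual_norm_le => [|x]; first by rewrite mulr_ge0.
by rewrite -mulrA [`|a| * _]mulrC; exact: bil_norm_ub.
Qed.

Lemma bil_row_norm f b : `|bil_row f b| <= `|f| * `|b|.
Proof.
apply: dual_norm_le => [|x]; first by rewrite mulr_ge0.
by rewrite -mulrA; exact: bil_norm_ub.
Qed.

Lemma dual_bound (E : normedModType R[i]) (L : dual (dual E)) (f : dual E) K :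
  `|f| <= K -> `|L f| <= `|L| * K.
Proof.
move=> fK; apply: le_trans (dual_norm_ub L f) _.
by rewrite ler_wpM2l ?(normr_ge0 L).
Qed.

Lemma bil_int_subproof (L : dual (dual A)) (f : bil A A) :
  (fun b => L (bil_row f b)) \in @dual_pred R A.
Proof.
apply: (@dual_predP _ _ _ (`|L| * `|f|)) => [k x y|x].
  have -> : bil_row f (k *: x + y) = k *: bil_row f x + bil_row f y.
    by apply: dual_ext => a /=; rewrite bilDl bilZl.
  by rewrite dual_linear.
by rewrite -mulrA; apply: dual_bound; exact: bil_row_norm.
Qed.

Definition bil_int L f : dual A := MkDual (bil_int_subproof L f).

Lemma bil_int_norm L f : `|bil_int L f| <= `|L| * `|f|.
Proof.
apply: dual_norm_le => [|x]; first by rewrite mulr_ge0.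
by rewrite -mulrA; apply: dual_bound; exact: bil_row_norm.
Qed.

Lemma bil_int_linear L : linear (bil_int L).
Proof.
move=> k f g; apply: dual_ext => b /=.
have -> : bil_row (k *: f + g) b = k *: bil_row f b + bil_row g b.
  exact: dual_ext.
by rewrite dual_linear.
Qed.

Lemma mul_form_subproof (psi : dual A) :
  (fun b a => psi (bmul b a)) \in @bil_pred R A A.
Proof.
apply/asboolP; split=> [a k x y|b k x y|].
- by rewrite bmulDl -bscalerAl dual_linear.
- by rewrite bmulDr -bscalerAr dual_linear.
- exists `|psi| => // b a; apply: le_trans (dual_norm_ub psi _) _.
  by rewrite ler_wpM2l ?(normr_ge0 psi)// bnormM.
Qed.

Definition mul_form psi : bil A A := MkBil (mul_form_subproof psi).

Lemma mul_form_linear : linear mul_form.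
Proof. by move=> k f g; apply: bil_ext. Qed.

Lemma mul_form_norm psi : `|mul_form psi| <= `|psi|.
Proof.
apply: bil_norm_le => // b a; apply: le_trans (dual_norm_ub psi _) _.
by rewrite ler_wpM2l ?(normr_ge0 psi)// bnormM.
Qed.

(** With [L] a two-sided identity in the bidual, [c |-> L dc] is a derivation
    into the bidual of the differentials, by the rule [d(ab) = (da) b + a db];
    if [z] implements it, then [L (x) L + z] is a virtual diagonal, where [b da]
    in [z] is read as [b (x) a - b a (x) L]. In an algebra with unit this is the
    usual argument for the derivation [c |-> 1 (x) c - c (x) 1]. *)
Theorem amenable_virtual_diagonal :
  exists M : dual (bil A A), virtual_diagonal M.
Proof.
have [L [Ll Lr]] := amenable_unit.
have D_subproof c : (fun f : bil A A => L (bil_col f c)) \in @dual_pred R (bil A A).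
  apply: (@dual_predP _ _ _ (`|L| * `|c|)) => [k f g|f].
    have -> : bil_col (k *: f + g) c = k *: bil_col f c + bil_col g c.
      exact: dual_ext.
    by rewrite dual_linear.
  rewrite -mulrA [`|c| * _]mulrC; apply: dual_bound; exact: bil_col_norm.
pose D (c : A) : dual (diff_bimod A) := MkDual (D_subproof c).
have [|||z zD] := @amenable_inner (diff_bimod A) D `|L|.
- move=> k x y; apply: dual_ext => f /=.
  have -> : bil_col f (k *: x + y) = k *: bil_col f x + bil_col f y.
    by apply: dual_ext => b /=; rewrite bilDr bilZr.
  by rewrite dual_linear.
- move=> c; apply: dual_norm_le => [|f]; first by rewrite mulr_ge0 ?(normr_ge0 L).
  rewrite /= -mulrA [`|c| * _]mulrC; apply: dual_bound; exact: bil_col_norm.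
- move=> c c'; apply: dual_ext => f.
  have -> : (ract (D c) c' + lact c (D c')) f =
      L (bil_col (lact c' f) c) + L (bil_col (ract f c) c') by [].
  pose g := dual_lact (E := regular_bimod A) c (bil_col f c').
  have -> : bil_col (lact c' f) c = bil_col f (bmul c c') - g by apply: dual_ext.
  rewrite dual_appB (Lr c (bil_col f c') g) => [|//].
  by rewrite (Ll c (bil_col f c') (bil_col (ract f c) c')) => [|//]; rewrite subrK.
have zE c (f : bil A A) : L (bil_col f c) =
    z (ract (f : diff_bimod A) c) - z (lact c (f : diff_bimod A)).
  exact: (congr1 (fun g : dual (bil A A) => g f) (zD c)).
have [||M ME] := @dual_exists R (bil A A)
  (fun f => L (bil_int L f) + z (f - mul_form (bil_int L f))).
- move=> k f g; rewrite bil_int_linear mul_form_linear.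
  have -> : k *: f + g - (k *: mul_form (bil_int L f) + mul_form (bil_int L g)) =
      k *: (f - mul_form (bil_int L f)) + (g - mul_form (bil_int L g)).
    by rewrite scalerBr opprD addrACA.
  by rewrite !dual_linear scalerDr addrACA.
- exists (`|L| * `|L| + `|z| * (1 + `|L|)) => f.
  rewrite mulrDl (le_trans (ler_normD _ _))// lerD//.
    by rewrite -mulrA; apply: dual_bound; exact: bil_int_norm.
  apply: le_trans (dual_norm_ub z _) _; rewrite -mulrA.
  rewrite ler_wpM2l ?(normr_ge0 z)//; apply: le_trans (ler_normB _ _) _.
  rewrite mulrDl mul1r lerD//; apply: le_trans (mul_form_norm _) _.
  exact: bil_int_norm.
exists M; split=> [c f f1 f2 f1E f2E|c psi f fE].
- have -> : M f2 = z (ract (f : diff_bimod A) c).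
    (* [f2 b a = f b (a c)], and [L] absorbs the integration over [a]. *)
    have i2 : bil_int L f2 = bil_col f c.
      by apply: dual_ext => b; apply: (Lr c (bil_row f b)) => a; exact: f2E.
    rewrite ME i2 zE.
    have -> : f2 - mul_form (bil_col f c) = lact c (f : diff_bimod A).
      apply: bil_ext => b a.
      have -> : (f2 - mul_form (bil_col f c)) b a = f2 b a - f (bmul b a) c by [].
      by rewrite f2E.
    by rewrite subrK.
  have -> : f1 = ract (f : diff_bimod A) c by exact: bil_ext.
  rewrite ME dual_appB.
  (* [z] implements [c |-> L dc]; on the form [mul_form _] the left action
     vanishes, as [b d(ac) - ba dc] multiplies out to zero. *)
  pose f0 : diff_bimod A := mul_form (bil_int L f).
  have := zE c f0; have -> : lact c f0 = 0.
    apply: bil_ext => b a; have -> : lact c f0 b a =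
      bil_int L f (bmul b (bmul a c)) - bil_int L f (bmul (bmul b a) c) by [].
    by rewrite bmulA subrr.
  rewrite dual_app0 subr0.
  have i1 b : bil_int L (ract (f : diff_bimod A) c) b = bil_int L f (bmul c b).
    by rewrite /=; congr (dual_fun L _); exact: dual_ext.
  have -> : ract f0 c = mul_form (bil_int L (ract (f : diff_bimod A) c)).
    apply: bil_ext => b a; have -> : ract f0 c b a =
      bil_int L f (bmul (bmul c b) a) by [].
    rewrite -[RHS]/(bil_int L (ract (f : diff_bimod A) c) (bmul b a)) i1.
    by rewrite bmulA.
  move=> <-.
  rewrite (Ll c (bil_int L f) _ i1).
  by rewrite (Lr c (bil_int L f)) => [|//]; rewrite addrC subrK.
- have i b : bil_int L f b = psi (bmul c b).
    rewrite -[LHS]/(L (bil_row f b)).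
    apply: (Ll (bmul c b) psi) => a; rewrite -[LHS]/(f b a) fE.
    by rewrite bmulA.
  rewrite ME; have -> : f - mul_form (bil_int L f) = 0.
    apply/eqP; rewrite subr_eq0; apply/eqP/bil_ext => b a.
    by rewrite -[RHS]/(bil_int L f (bmul b a)) i fE.
  by rewrite dual_app0 addr0; apply: (Ll c psi).
Qed.

End AmenableVirtualDiagonal.

Section VirtualDiagonalAmenable.
Variables (R : realType) (B : banachAlgType R) (M : dual (bil B B)).
Hypothesis vdM : virtual_diagonal M.

(** The product of a virtual diagonal is by definition an identity on one side;
    moving elements of [B] across the diagonal gives the other side. *)
Lemma vd_unit : exists N : dual (dual B),
  [/\ forall (psi : dual B) (f : bil B B), (forall b a, f b a = psi (bmul b a)) ->
        N psi = M f,
      forall c (psi f : dual B), (forall b, f b = psi (bmul c b)) ->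
        N f = psi c &
      forall c (psi f : dual B), (forall b, f b = psi (bmul b c)) ->
        N f = psi c].
Proof.
have [comm unit] := vdM.
have [||N NE] := @dual_exists R (dual B) (fun psi => M (mul_form psi)).
- by move=> k f g; rewrite mul_form_linear dual_linear.
- exists `|M| => psi; apply: le_trans (dual_norm_ub M _) _.
  by rewrite ler_wpM2l ?(normr_ge0 M)// mul_form_norm.
exists N; split=> [psi f fE|c psi f fE|c psi f fE]; rewrite NE.
- by congr (dual_fun M _); apply: bil_ext => b a; rewrite fE.
- by apply: (unit c psi) => b a; rewrite -fE.
- have [f1 f1E] : exists f1 : bil B B, forall b a, f1 b a = psi (bmul c (bmul b a)).
    by exists (mul_form (dual_ract (E := regular_bimod B) psi c)).
  rewrite -(unit c psi f1 f1E); symmetry.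
  apply: (comm c (mul_form psi)) => b a; first by rewrite f1E /= bmulA.
  by rewrite /= fE bmulA.
Qed.

Variables (E : banachBimodType B).

Lemma orbit_subproof (l : dual E) (x : E) :
  (fun y : B => l (ract x y)) \in @dual_pred R B.
Proof.
have [C C0 hC] := act_bounded_ge0 E.
apply: (@dual_predP _ _ _ (`|l| * C * `|x|)) => [k y z|y].
  by rewrite ractDr ractZr dual_linear.
apply: le_trans (dual_norm_ub l _) _; rewrite -!mulrA.
rewrite ler_wpM2l ?(normr_ge0 l)// [`|x| * _]mulrC mulrA.
by have [] := hC y x.
Qed.

Definition orbit l x : dual B := MkDual (orbit_subproof l x).

Lemma orbit_bounded : exists2 C : R[i], 0 <= C &
  forall l x, `|orbit l x| <= C * `|l| * `|x|.
Proof.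
have [C C0 hC] := act_bounded_ge0 E; exists C => // l x.
apply: dual_norm_le => [|y]; first by rewrite !mulr_ge0 ?(normr_ge0 l).
apply: le_trans (dual_norm_ub l _) _.
rewrite [C * _]mulrC -!mulrA ler_wpM2l ?(normr_ge0 l)//.
by rewrite [`|x| * _]mulrC mulrA; have [] := hC y x.
Qed.

Lemma orbit_linearl x : linear (orbit^~ x).
Proof. by move=> k l m; apply: dual_ext. Qed.

Lemma orbit_linearr l : linear (orbit l).
Proof.
by move=> k x y; apply: dual_ext => b; rewrite /= ractDl ractZl dual_linear.
Qed.

(** The average of [f . D g] over the diagonal implements [D], provided the
    identity [N] of the bidual acts as such on the range of [D]: moving [a]
    across the diagonal produces [D (g a) - (D g) a = g . D a], whose average is
    the action of [N] on [D a]. *)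
Lemma essential_derivation_inner (N : dual (dual B)) (D : B -> dual E)
    (K : R[i]) :
  (forall (psi : dual B) (f : bil B B), (forall b a, f b a = psi (bmul b a)) ->
     N psi = M f) ->
  0 <= K -> linear D -> (forall a, `|D a| <= K * `|a|) -> derivation D ->
  (forall a x, N (orbit (D a) x) = D a x) -> inner D.
Proof.
move=> NE K0 lD DK dD ND; have [comm _] := vdM.
have [C C0 hC] := act_bounded_ge0 E.
have F_le f g x : `|D g (ract x f)| <= K * C * `|x| * (`|f| * `|g|).
  apply: le_trans (dual_norm_ub (D g) _) _.
  have -> : K * C * `|x| * (`|f| * `|g|) = (K * `|g|) * (C * `|f| * `|x|) by ring.
  by apply: ler_pM (DK g) _ => //; have [] := hC f x.
have F_subproof x : (fun f g => D g (ract x f)) \in @bil_pred R B B.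
  apply/asboolP; split=> [g k y z|f k y z|].
  - by rewrite ractDr ractZr dual_linear.
  - by rewrite lD.
  - by exists (K * C * `|x|) => //; rewrite !mulr_ge0.
pose F x : bil B B := MkBil (F_subproof x).
have [||z zE] := @dual_exists R E (fun x => M (F x)).
- move=> k x y; have -> : F (k *: x + y) = k *: F x + F y.
    by apply: bil_ext => f g; rewrite /= ractDl ractZl dual_linear.
  by rewrite dual_linear.
- exists (`|M| * (K * C)) => x; apply: le_trans (dual_norm_ub M _) _.
  rewrite -mulrA ler_wpM2l ?(normr_ge0 M)//.
  by apply: bil_norm_le => [|f g]; [rewrite !mulr_ge0|exact: F_le].
exists z => a; apply: dual_ext => x.
have -> : (lact a z - ract z a) x = z (ract x a) - z (lact a x) by [].
rewrite !zE -ND.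
have [f2 f2E] : exists f2 : bil B B, forall f g, f2 f g = D (bmul g a) (ract x f).
  apply: bil_exists => [g k y w|f k y w|].
  - by rewrite ractDr ractZr dual_linear.
  - by rewrite bmulDl -bscalerAl lD.
  - have [L L0 FL] := bil_bounded (F x).
    exists (L * `|a|) => [|f g]; first by rewrite mulr_ge0.
    apply: le_trans (FL f (bmul g a)) _.
    by rewrite -mulrA ler_wpM2l// mulrCA ler_wpM2l// mulrC bnormM.
have -> : M (F (ract x a)) = M f2.
  by apply: (comm a (F x)) => f g; rewrite ?f2E//= ractA.
have -> : f2 = F (lact a x) + mul_form (orbit (D a) x).
  apply: bil_ext => f g; rewrite f2E dD.
  have -> : (ract (D g) a + lact g (D a)) (ract x f) =
    D g (lact a (ract x f)) + D a (ract (ract x f) g) by [].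
  by rewrite lractA -ractA.
by rewrite dual_appD addrC addKr; apply: NE.
Qed.

(** For an arbitrary module [E], the identity [N] of the bidual acts on [dual E]
    from the left as a projection [P], and [P] fixes every [a . l].
    Hence [T = D - P D] is a right module map, [T a] is [zeta . a] with [zeta]
    the average of [T], and [a . zeta = 0]: so [T] is inner. The remaining part
    [P D] falls under the previous lemma. *)
Theorem virtual_diagonal_inner (D : {linear B -> dual E}) :
  continuous D -> derivation D -> inner D.
Proof.
move=> cD dD; have [K K0 DK] := bounded_of_continuous cD.
have [N [NM Nl Nr]] := vd_unit; have [C C0 hC] := orbit_bounded.
have P_subproof l : (fun x => N (orbit l x)) \in @dual_pred R E.
  apply: (@dual_predP _ _ _ (`|N| * (C * `|l|))) => [k x y|x].
    by rewrite orbit_linearr dual_linear.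
  by rewrite -mulrA; apply: dual_bound.
pose P l : dual E := MkDual (P_subproof l).
have P_linear : linear P.
  by move=> k l m; apply: dual_ext => x; rewrite /= orbit_linearl dual_linear.
have P_le l : `|P l| <= `|N| * C * `|l|.
  apply: dual_norm_le => [|x]; first by rewrite !mulr_ge0 ?(normr_ge0 N, normr_ge0 l).
  by rewrite -[`|N| * _ * _]mulrA -mulrA; apply: dual_bound.
have P_ract l x a : P l (ract x a) = l (ract x a).
  by apply: (Nl a (orbit l x)) => b; rewrite /= ractA.
have P_lact l x a : P (lact a l) x = l (ract x a).
  apply: (Nr a (orbit l x)) => b.
  have -> : orbit (lact a l) x b = l (ract (ract x b) a) by [].
  by rewrite -ractA.
pose T a := D a - P (D a).
have T_linear : linear T.
  by move=> k a b; rewrite /T linearP P_linear opprD addrACA scalerBr.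
have T_le a : `|T a| <= (1 + `|N| * C) * K * `|a|.
  apply: le_trans (ler_normB _ _) _; rewrite -mulrA mulrDl mul1r lerD//.
  apply: le_trans (P_le _) _; rewrite ler_wpM2l// mulr_ge0 ?(normr_ge0 N)//.
have NC0 : 0 <= (1 + `|N| * C) * K.
  by rewrite mulr_ge0// addr_ge0// mulr_ge0// (normr_ge0 N).
have T_mul b a x : T (bmul b a) x = T b (lact a x).
  have -> : T (bmul b a) x = D (bmul b a) x - P (D (bmul b a)) x by [].
  have -> : P (D (bmul b a)) x = P (ract (D b) a) x + P (lact b (D a)) x.
    by rewrite dD -[ract _ _]scale1r P_linear !scale1r.
  rewrite P_lact dD.
  have -> : (ract (D b) a + lact b (D a)) x = D b (lact a x) + D a (ract x b) by [].
  have -> : P (ract (D b) a) x = P (D b) (lact a x).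
    by rewrite /=; congr (dual_fun N _); apply: dual_ext => y; rewrite /= lractA.
  by rewrite opprD addrACA subrr addr0.
have tr_subproof x : (fun b => T b x) \in @dual_pred R B.
  apply: (@dual_predP _ _ _ ((1 + `|N| * C) * K * `|x|)) => [k a b|b].
    by rewrite T_linear.
  apply: le_trans (dual_norm_ub (T b) _) _.
  by rewrite [leRHS]mulrAC ler_wpM2r ?T_le.
pose tr x : dual B := MkDual (tr_subproof x).
have [||zeta zetaE] := @dual_exists R E (fun x => N (tr x)).
- move=> k x y; have -> : tr (k *: x + y) = k *: tr x + tr y.
    by apply: dual_ext => b; exact: dual_linear (T b) _ _ _.
  by rewrite dual_linear.
- exists (`|N| * ((1 + `|N| * C) * K)) => x; rewrite -mulrA; apply: dual_bound.
  apply: dual_norm_le => [|b]; first by rewrite mulr_ge0.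
  apply: le_trans (dual_norm_ub (T b) _) _.
  by rewrite [leRHS]mulrAC ler_wpM2r ?T_le.
have zeta_ract a x : zeta (ract x a) = 0.
  rewrite zetaE; have -> : tr (ract x a) = 0.
    apply: dual_ext => b.
    have -> : tr (ract x a) b = D b (ract x a) - P (D b) (ract x a) by [].
    by rewrite P_ract subrr.
  by rewrite dual_app0.
have zeta_lact a x : zeta (lact a x) = T a x.
  by rewrite zetaE; apply: (Nr a (tr x)) => b; rewrite -[RHS]/(T (bmul b a) x) T_mul.
have PDE a x : P (D a) x = D a x - zeta (lact a x) + zeta (ract x a).
  rewrite zeta_ract addr0 zeta_lact.
  by have -> : T a x = D a x - P (D a) x by []; rewrite subKr.
have [|||||z zE] := @essential_derivation_inner N (fun a => P (D a)) (`|N| * C * K) NM.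
- by rewrite !mulr_ge0 ?(normr_ge0 N).
- by move=> k a b; rewrite linearP P_linear.
- move=> a; apply: le_trans (P_le _) _; rewrite -[leRHS]mulrA ler_wpM2l//.
  by rewrite mulr_ge0 ?(normr_ge0 N).
- move=> a b; apply: dual_ext => x.
  have -> : (ract (P (D a)) b + lact a (P (D b))) x =
    P (D a) (lact b x) + P (D b) (ract x a) by [].
  rewrite !PDE dD.
  have -> : (ract (D a) b + lact a (D b)) x = D a (lact b x) + D b (ract x a) by [].
  rewrite !zeta_ract !addr0 lactA lractA zeta_ract subr0 addrAC.
  by [].
- move=> a x; have -> : orbit (P (D a)) x = orbit (D a) x.
    by apply: dual_ext => y; rewrite /= -[LHS]/(P (D a) (ract x y)) P_ract.
  by [].
exists (z - zeta) => a; apply: dual_ext => x.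
have -> : (lact a (z - zeta) - ract (z - zeta) a) x =
  (lact a z - ract z a) x + zeta (lact a x) - zeta (ract x a).
  have -> : (lact a z - ract z a) x = z (ract x a) - z (lact a x) by [].
  have -> : (lact a (z - zeta) - ract (z - zeta) a) x =
    z (ract x a) - zeta (ract x a) - (z (lact a x) - zeta (lact a x)) by [].
  by rewrite opprB addrACA [z _ - z _ + _]addrAC -[RHS]addrA [- _ - _ in RHS]addrC.
by rewrite -zE PDE zeta_ract addr0 subr0 subrK.
Qed.

End VirtualDiagonalAmenable.

Theorem amenable_virtual_diagonalP (R : realType) (B : banachAlgType R) :
  amenable B <-> exists M : dual (bil B B), virtual_diagonal M.
Proof.
split=> [|[M vdM] E D]; first exact: amenable_virtual_diagonal.
exact: (@virtual_diagonal_inner R B M vdM E D).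
Qed.

(** * Cutoffs, elementary tensors and their density *)

Section Multipliers.
Variables (R : realType) (X : topologicalType).
Local Open Scope complex_scope.

Lemma continuous_complex (a b : X -> R) : continuous a -> continuous b ->
  continuous (fun x => Complex (a x) (b x) : (R[i])^o).
Proof.
move=> ca cb x; apply/cvgrPdist_lt => e e0.
have e2 : 0 < complex.Re e / 2.
  by rewrite divr_gt0// -ltcR -ge0_ReE// ltW.
move: (ca x) (cb x) => /cvgrPdist_lt/(_ _ e2) ha /cvgrPdist_lt/(_ _ e2) hb.
apply: filterS2 ha hb => y /= ha hb; apply: le_lt_trans (norm_le_ReIm _) _.
by rewrite [ltRHS]ge0_ReE 1?ltW// ltcR/= (splitr (complex.Re e)) ltrD.
Qed.

Lemma real_continuous_complex (a : X -> R) : continuous a ->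
  continuous (fun x => (a x)%:C : (R[i])^o).
Proof. by move=> ca; apply: (continuous_complex ca) => x; exact: cvg_cst. Qed.

(** The bound by one makes the action on [C0 X V] contractive. *)
Record mult := MkMult {
  mult_fun :> X -> (R[i])^o;
  mult_continuous : continuous mult_fun;
  mult_le1 : forall x, `|mult_fun x| <= 1
}.

Lemma mult_ext (m n : mult) : m =1 n -> m = n.
Proof.
case: m n => [m cm m1] [n cn n1] /= /funext mn; subst n.
by congr MkMult; exact: Prop_irrelevance.
Qed.

Lemma mult_mul_subproof (m n : mult) :
  continuous (fun x => m x * n x : (R[i])^o) /\ forall x, `|m x * n x| <= 1.
Proof.
split=> x; first by apply: (@cvgM R[i]); exact: mult_continuous.
by rewrite normrM mulr_ile1// mult_le1.
Qed.

Definition mult_mul m n : mult :=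
  MkMult (mult_mul_subproof m n).1 (mult_mul_subproof m n).2.

Lemma mult_one_subproof :
  continuous (fun _ : X => 1 : (R[i])^o) /\ forall x : X, `|1 : R[i]| <= 1.
Proof. by split=> x; [exact: cvg_cst|rewrite normr1]. Qed.

Definition mult_one : mult := MkMult mult_one_subproof.1 mult_one_subproof.2.

Lemma mult_act_subproof (V : completeNormedModType R[i]) (m : mult) (f : C0 X V) :
  (fun x => m x *: f x) \in @C0_pred R X V.
Proof.
apply/asboolP; split=> [x|e e0].
  by apply: (@cvgZ R[i]); [exact: mult_continuous|exact: C0_continuous].
have [K cK fK] := C0_vanishes f e0; exists K => // x /fK; apply: le_lt_trans.
by rewrite normrZ ler_piMl// mult_le1.
Qed.

Definition mult_act (V : completeNormedModType R[i]) (m : mult) (f : C0 X V) :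
  C0 X V := MkC0 (mult_act_subproof m f).

(** Real values, so that the pointwise order directs the cutoffs: limits along
    this order play the part of an approximate identity of [C0 X]. *)
Record cutoff := MkCutoff {
  cutoff_fun :> X -> R;
  cutoff_continuous : continuous cutoff_fun;
  cutoff_ge0 : forall x, 0 <= cutoff_fun x;
  cutoff_le1 : forall x, cutoff_fun x <= 1;
  cutoff_vanishes : forall e, 0 < e ->
    exists2 K, compact K & forall x, ~ K x -> cutoff_fun x < e
}.

Lemma cutoff_mult_subproof (p : cutoff) :
  continuous (fun x => (p x)%:C : (R[i])^o) /\ forall x, `|(p x)%:C| <= 1.
Proof.
split=> [|x]; first exact: real_continuous_complex (@cutoff_continuous p).
by rewrite ger0_norm ?ler0c ?cutoff_ge0// lecR cutoff_le1.
Qed.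

Definition cutoff_mult (p : cutoff) : mult :=
  MkMult (cutoff_mult_subproof p).1 (cutoff_mult_subproof p).2.

Lemma cutoff_mul_subproof (p q : cutoff) :
  [/\ continuous (fun x => p x * q x), forall x, 0 <= p x * q x,
      forall x, p x * q x <= 1 &
      forall e, 0 < e -> exists2 K, compact K & forall x, ~ K x -> p x * q x < e].
Proof.
split=> [x|x|x|e e0].
- by apply: cvgM; exact: cutoff_continuous.
- by rewrite mulr_ge0 ?cutoff_ge0.
- by rewrite mulr_ile1 ?cutoff_ge0 ?cutoff_le1.
- have [K cK pK] := cutoff_vanishes p e0; exists K => // x /pK; apply: le_lt_trans.
  by rewrite ler_piMr ?cutoff_ge0 ?cutoff_le1.
Qed.

Definition cutoff_mul (p q : cutoff) : cutoff :=
  let: And4 c g l v := cutoff_mul_subproof p q in MkCutoff c g l v.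

Lemma cutoff_mulE p q x : cutoff_mul p q x = p x * q x.
Proof. by rewrite /cutoff_mul; case: (cutoff_mul_subproof p q). Qed.

Lemma cutoff_max_exists (p q : cutoff) : exists r : cutoff,
  forall x, r x = Num.max (p x) (q x).
Proof.
have c : continuous (fun x => Num.max (p x) (q x) : R).
  move=> x; apply: (@continuous_max _ _ p q).
    exact: cutoff_continuous.
  exact: cutoff_continuous.
have g x : 0 <= Num.max (p x) (q x) by rewrite le_max cutoff_ge0.
have l x : Num.max (p x) (q x) <= 1 by rewrite ge_max !cutoff_le1.
have v e : 0 < e ->
    exists2 K, compact K & forall x, ~ K x -> Num.max (p x) (q x) < e.
  move=> e0; have [K cK pK] := cutoff_vanishes p e0.
  have [L cL qL] := cutoff_vanishes q e0; exists (K `|` L); first exact: compactU.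
  by move=> x /not_orP[Kx Lx]; rewrite gt_max pK// qL.
by exists (MkCutoff c g l v).
Qed.

Definition unimodular (w : mult) := forall x, `|w x| = 1.

(** [p] is the real part of [w = p + i sqrt (1 - p^2)], which has modulus one. *)
Lemma cutoff_unimodular (p : cutoff) : exists w w' : mult,
  [/\ unimodular w, unimodular w', forall x, w x * w' x = 1 &
      forall x, (p x)%:C = 2^-1 * (w x + w' x)].
Proof.
pose s x := Num.sqrt (1 - p x ^+ 2).
have s2 x : s x ^+ 2 = 1 - p x ^+ 2.
  by rewrite sqr_sqrtr// subr_ge0 expr_le1 ?cutoff_ge0 ?cutoff_le1.
have cs : continuous s.
  move=> x; apply: (@continuous_comp _ _ _ (fun x => 1 - p x ^+ 2) Num.sqrt).
    apply: cvgB; first exact: cvg_cst.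
    by rewrite expr2; apply: cvgM; exact: cutoff_continuous.
  exact: sqrt_continuous.
have cNs : continuous (fun x => - s x) by move=> x; apply: cvgN; exact: cs.
have n1 x : `|p x +i* s x| = 1.
  by rewrite normc_def /= s2 addrC subrK sqrtr1.
have n2 x : `|p x +i* (- s x)| = 1.
  by rewrite normc_def /= sqrrN s2 addrC subrK sqrtr1.
have c1 := continuous_complex (@cutoff_continuous p) cs.
have c2 := continuous_complex (@cutoff_continuous p) cNs.
have l1 x : `|p x +i* s x| <= 1 by rewrite n1.
have l2 x : `|p x +i* (- s x)| <= 1 by rewrite n2.
exists (MkMult c1 l1), (MkMult c2 l2); split=> //= x.
- by simpc; rewrite -!expr2 s2 addrC subrK [s x * _]mulrC addNr.
- have -> : (p x +i* s x) + (p x -i* s x) = (p x)%:C + (p x)%:C.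
    by apply: (congr2 (@Complex R)); rewrite ?addr0//= subrr.
  by rewrite -mulr2n -[(p x)%:C *+ 2]mulr_natl mulKf.
Qed.

(** Local compactness and complete regularity separate a point from the
    complement of a compact neighbourhood. *)
Lemma cutoff_at (x0 : X) : hausdorff_space X -> locally_compact [set: X] ->
  exists p : cutoff, p x0 = 1.
Proof.
move=> hX lcX; have [U Ux0 [cU clU]] := lcX x0 I; rewrite withinET in Ux0.
have nB : ~ (~` U^°) x0 by apply.
have clB : closed (~` U^°) by apply: open_closedC; exact: open_interior.
have := @locally_compact_completely_regular X R lcX hX x0 _ clB nB.
move=> /(@uniform_separatorP _ R)[f [cf f01 f0 f1]].
have f01' x : 0 <= f x <= 1.
  by have := f01 (f x) ltac:(by exists x); rewrite /= in_itv.
have c : continuous (fun x => 1 - f x).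
  by move=> x; apply: cvgB; [exact: cvg_cst|exact: cf].
have g x : 0 <= 1 - f x by rewrite subr_ge0; have /andP[] := f01' x.
have l x : 1 - f x <= 1 by rewrite gerBl; have /andP[] := f01' x.
have v e : 0 < e -> exists2 K, compact K & forall x, ~ K x -> 1 - f x < e.
  move=> e0; exists U => // x Ux; rewrite (f1 (f x)) ?subrr//.
  by exists x => //; apply: contra_not Ux; exact: interior_subset.
exists (MkCutoff c g l v) => /=.
by rewrite (f0 (f x0)) ?subr0//; exists x0.
Qed.

End Multipliers.

Section Tensors.
Variables (R : realType) (X : topologicalType) (A : banachAlgType R).
Local Open Scope complex_scope.
Implicit Types (p q u : cutoff R X) (a b : A).

Lemma tens_subproof p a : (fun x => (p x)%:C *: a) \in @C0_pred R X A.
Proof.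
apply/asboolP; split=> [x|e e0].
  apply: (@cvgZr_tmp R[i]).
  exact: (real_continuous_complex (@cutoff_continuous _ _ p)).
have a1 : 0 < `|a| + 1 by rewrite ltr_wpDl.
have e1 : 0 < complex.Re (e / (`|a| + 1)).
  by rewrite -ltcR -ge0_ReE ?divr_gt0// ltW// divr_gt0.
have [K cK pK] := cutoff_vanishes p e1; exists K => // x /pK.
rewrite -ltcR -ge0_ReE ?divr_ge0 1?ltW// ltr_pdivlMr//; apply: le_lt_trans.
by rewrite normrZ ger0_norm ?ler0c ?cutoff_ge0// ler_wpM2l ?ler0c ?cutoff_ge0// lerDl.
Qed.

(** The elementary tensor [p (x) a]. *)
Definition tens p a : C0 X A := MkC0 (tens_subproof p a).

Lemma C0_ext (V : completeNormedModType R[i]) (f g : C0 X V) : f =1 g -> f = g.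
Proof. by move=> fg; apply/val_inj/funext. Qed.

Lemma tens_linear p : linear (tens p).
Proof.
move=> k a b; apply: C0_ext => x.
rewrite -[RHS]/(k *: ((p x)%:C *: a) + (p x)%:C *: b) /=.
by rewrite scalerDr !scalerA [k * _]mulrC.
Qed.

Lemma tens_norm p a : `|tens p a| <= `|a|.
Proof.
apply: C0_norm_le => // x; rewrite normrZ ler_piMl//.
by rewrite ger0_norm ?ler0c ?cutoff_ge0// lecR cutoff_le1.
Qed.

Lemma tensM p q a b : bmul (tens p a) (tens q b) = tens (cutoff_mul p q) (bmul a b).
Proof.
apply: C0_ext => x.
rewrite /= cutoff_mulE -[LHS]/(bmul ((p x)%:C *: a) ((q x)%:C *: b)).
by rewrite -bscalerAl -bscalerAr scalerA rmorphM.
Qed.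

Lemma cutoff_actE p q a : mult_act (cutoff_mult p) (tens q a) = tens (cutoff_mul p q) a.
Proof. by apply: C0_ext => x; rewrite /= cutoff_mulE scalerA rmorphM. Qed.

Lemma mult_act_linear (m : mult R X) : linear (@mult_act R X A m).
Proof.
move=> k f g; apply: C0_ext => x.
rewrite -[RHS]/(k *: (m x *: f x) + m x *: g x).
rewrite -[LHS]/(m x *: (k *: f x + g x)).
by rewrite scalerDr !scalerA [k * _]mulrC.
Qed.

Lemma mult_act_norm (m : mult R X) (f : C0 X A) : `|mult_act m f| <= `|f|.
Proof.
apply: C0_norm_le => // x; rewrite normrZ.
by apply: le_trans (C0_norm_ub f x); rewrite ler_piMl// mult_le1.
Qed.

Lemma mult_actM (m n : mult R X) (f : C0 X A) :
  mult_act (mult_mul m n) f = mult_act m (mult_act n f).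
Proof. by apply: C0_ext => x /=; rewrite scalerA. Qed.

Lemma mult_actMl (m : mult R X) (f g : C0 X A) :
  bmul (mult_act m f) g = mult_act m (bmul f g).
Proof. by apply: C0_ext => x; rewrite /= [RHS]bscalerAl. Qed.

Lemma mult_actMr (m : mult R X) (f g : C0 X A) :
  bmul f (mult_act m g) = mult_act m (bmul f g).
Proof. by apply: C0_ext => x; rewrite /= [RHS]bscalerAr. Qed.

End Tensors.

Section Density.
Variables (R : realType) (X : topologicalType) (A : banachAlgType R).
Local Open Scope complex_scope.

Lemma rnorm_cvg (f : X -> A) : continuous f -> continuous (fun x => rnorm (f x)).
Proof.
by move=> cf x; exact: (continuous_comp (cf x) (@rnorm_continuous _ _ _)).
Qed.

Lemma C0_finite_net (f : C0 X A) (e : R) : 0 < e ->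
  exists s : seq A, forall x, e <= rnorm (f x) ->
    exists2 a, a \in s & rnorm (f x - a) < e.
Proof.
move=> e0; have e0' : 0 < e%:C :> R[i] by rewrite ltcR.
have [K cK fK] := C0_vanishes f e0'.
have cfK : compact (f @` K).
  by apply: continuous_compact cK; apply: continuous_subspaceT; exact: C0_continuous.
move: cfK; rewrite compact_cover.
move=> /(_ A [set: A] (fun a => [set b | rnorm (b - a) < e])) [a _||D _ fD].
- have -> : [set b | rnorm (b - a) < e] = ball a e%:C.
    apply/seteqP; split=> b /=; rewrite -ball_normE /= distrC rnormE ltcR//.
  exact: ball_open.
- move=> a _; exists a => //=; by rewrite /rnorm subrr normr0.
exists (finmap.enum_fset D) => x ex.
have Kx : K x by apply: contrapT => /fK; rewrite rnormE ltcR ltNge ex.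
have [a aD ax] := fD (f x) ltac:(by exists x).
by exists a.
Qed.

Lemma C0_sumE (I : Type) (s : seq I) (F : I -> C0 X A) x :
  (\sum_(i <- s) F i) x = \sum_(i <- s) F i x.
Proof. by elim/big_rec2 : _ => //= i y1 y2 _ <-. Qed.

(** The partition of unity is made from [f] itself: the functions
    [max 0 (e - |f - a|)], for [a] in a finite net containing zero, are
    normalised, and truncated by [q = min 1 (max 0 (|f| / e - 1))]. A local unit
    for [q] is [p = min 1 (|f| / e)]. The truncation costs [2 e] and the
    partition costs [e]. *)
Lemma C0_approx (f : C0 X A) (e : R) : 0 < e ->
  exists (p : cutoff R X) (s : seq A) (u : A -> cutoff R X),
    (forall a x, a \in s -> p x * u a x = u a x) /\
    `|f - \sum_(a <- s) tens (u a) a| <= (3 * e)%:C.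
Proof.
move=> e0; have [s0 s0P] := C0_finite_net f e0.
pose t x := rnorm (f x).
have ct : continuous t by apply: rnorm_cvg; exact: C0_continuous.
have t0 x : 0 <= t x by exact: rnorm_ge0.
have cmin (g : X -> R) : continuous g -> continuous (fun x => Num.min 1 (g x)).
  move=> cg x; apply: (@continuous_min _ _ (fun=> 1) g); first exact: cvg_cst.
  exact: cg.
have cmax (g : X -> R) : continuous g -> continuous (fun x => Num.max 0 (g x)).
  move=> cg x; apply: (@continuous_max _ _ (fun=> 0) g); first exact: cvg_cst.
  exact: cg.
have cte : continuous (fun x => t x / e).
  by move=> x; apply: cvgMr_tmp; exact: ct.
have [p pE] : exists p : cutoff R X, forall x, p x = Num.min 1 (t x / e).
  have g x : 0 <= Num.min 1 (t x / e) by rewrite le_min ler01 divr_ge0// ltW.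
  have l x : Num.min 1 (t x / e) <= 1 by rewrite ge_min lexx.
  have v d : 0 < d -> exists2 K, compact K & forall x, ~ K x -> Num.min 1 (t x / e) < d.
    move=> d0; have de : 0 < (d * e)%:C :> R[i] by rewrite ltcR mulr_gt0.
    have [K cK fK] := C0_vanishes f de; exists K => // x /fK.
    by rewrite rnormE ltcR => tx; rewrite gt_min ltr_pdivrMr// tx orbT.
  by exists (MkCutoff (cmin _ cte) g l v).
pose q x := Num.min 1 (Num.max 0 (t x / e - 1)).
have cq : continuous q.
  apply: cmin; apply: cmax => x; apply: cvgB; first exact: cte.
  exact: cvg_cst.
have q0 x : 0 <= q x by rewrite le_min ler01 le_max lexx.
have q1 x : q x <= 1 by rewrite ge_min lexx.
have qp x : q x <= p x.
  rewrite pE /q le_min ge_min lexx /= ge_min; apply/orP; right.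
  by rewrite ge_max gerBl ler01 andbT divr_ge0// ltW.
have pq x : p x * q x = q x.
  rewrite pE /q; case: (leP (t x / e - 1) 0) => te.
    by rewrite (min_r ler01) mulr0.
  rewrite [X in X * _]min_l ?mul1r//.
  by rewrite subr_gt0 in te; exact: ltW.
have tq x : (1 - q x) * t x <= 2 * e.
  have [t2|t2] := leP (t x) (2 * e).
    by apply: le_trans t2; rewrite ler_piMl// gerBl.
  have -> : q x = 1; last by rewrite subrr mul0r mulr_ge0// ltW.
  rewrite /q min_l// le_max; apply/orP; right.
  by rewrite lerBrDr ler_pdivlMr// ltW.
pose s := 0 :: s0.
pose g a x := Num.max 0 (e - rnorm (f x - a)).
have cg a : continuous (g a).
  apply: cmax => x; apply: cvgB; first exact: cvg_cst.
  apply: (rnorm_cvg (f := fun x => f x - a)) => {}x.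
  by apply: cvgB; [exact: C0_continuous|exact: cvg_cst].
have g0 a x : 0 <= g a x by rewrite le_max lexx.
pose G x := \sum_(a <- s) g a x.
have gG a x : a \in s -> g a x <= G x.
  move=> sa; rewrite /G (big_rem a)//= lerDl sumr_ge0// => b _; exact: g0.
have G0 x : 0 < G x.
  have [a sa xa] : exists2 a, a \in s & rnorm (f x - a) < e.
    have [tx|tx] := leP e (t x).
      by have [a sa xa] := s0P x tx; exists a => //; rewrite inE sa orbT.
    by exists 0; rewrite ?inE ?eqxx// subr0.
  apply: lt_le_trans (gG a x sa).
  by rewrite lt_max subr_gt0 xa orbT.
have cG : continuous G.
  by apply: (continuous_big (P := xpredT) (@add_continuous R)) => a _; exact: cg.
have [u uE] : exists u : A -> cutoff R X, forall a x, a \in s ->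
    u a x = q x * (g a x / G x).
  suff uex a : exists v : cutoff R X, a \in s -> forall x, v x = q x * (g a x / G x).
    by exists (fun a => projT1 (cid (uex a))) => a x sa; case: cid => /= v ->.
  have [sa|_] := boolP (a \in s); last by exists p.
  have c : continuous (fun x => q x * (g a x / G x)).
    move=> x; apply: cvgM; first exact: cq.
    apply: cvgM; first exact: cg.
    by apply: cvgV; [rewrite gt_eqF|exact: cG].
  have r0 x : 0 <= g a x / G x by rewrite divr_ge0// ltW.
  have r1 x : g a x / G x <= 1 by rewrite ler_pdivrMr// mul1r gG.
  have l x : q x * (g a x / G x) <= 1 by rewrite mulr_ile1.
  have v d : 0 < d -> exists2 K, compact K & forall x, ~ K x -> q x * (g a x / G x) < d.
    move=> d0; have [K cK pK] := cutoff_vanishes p d0; exists K => // x /pK.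
    apply: le_lt_trans; apply: le_trans (qp x).
    by rewrite ler_piMr.
  by exists (MkCutoff c (fun x => mulr_ge0 (q0 x) (r0 x)) l v).
exists p, s, u; split=> [a x sa|]; first by rewrite uE// [LHS]mulrA (pq x).
apply: C0_norm_le => [|x]; first by rewrite ler0c mulr_ge0// ltW.
have -> : (f - \sum_(a <- s) tens (u a) a) x =
    (1 - q x)%:C *: f x + \sum_(a <- s) (q x * (g a x / G x))%:C *: (f x - a).
  have sumg : \sum_(a <- s) (q x * (g a x / G x))%:C = (q x)%:C :> R[i].
    rewrite -rmorph_sum /= -mulr_sumr -mulr_suml divff ?mulr1//.
    by rewrite gt_eqF// -/(G x) G0.
  have -> : (f - \sum_(a <- s) tens (u a) a) x =
    f x - (\sum_(a <- s) tens (u a) a) x by [].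
  rewrite C0_sumE rmorphB /= scalerBl scale1r -addrA; congr (_ + _).
  under [in RHS]eq_bigr do rewrite scalerBr.
  rewrite sumrB -scaler_suml sumg addrA addNr add0r; congr (- _).
  by apply: eq_big_seq => a sa; rewrite /= uE.
apply: le_trans (ler_normD _ _) _.
have -> : (3 * e)%:C = (2 * e)%:C + e%:C :> R[i].
  by rewrite -rmorphD; congr (_%:C); ring.
apply: lerD.
  rewrite normrZ ger0_norm ?ler0c ?subr_ge0// rnormE -rmorphM lecR.
  exact: tq.
apply: le_trans (ler_norm_sum _ _ _) _.
have -> : e%:C = \sum_(a <- s) (g a x / G x * e)%:C :> R[i].
  rewrite -rmorph_sum /= -mulr_suml -mulr_suml divff ?mul1r//.
  by rewrite gt_eqF// -/(G x) G0.
(* [g a] vanishes where [|f - a| >= e]. *)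
have gr a : g a x * rnorm (f x - a) <= g a x * e.
  have [ra|ra] := leP e (rnorm (f x - a)); last by rewrite ler_wpM2l// ltW.
  have -> : g a x = 0 by rewrite /g max_l// subr_le0.
  by rewrite !mul0r.
apply: ler_sum => a _; rewrite normrZ (rnormE (f x - a)).
have Gi : 0 <= (G x)^-1 by rewrite invr_ge0 ltW.
have gG0 : 0 <= g a x / G x by rewrite mulr_ge0.
rewrite ger0_norm ?ler0c ?mulr_ge0// -rmorphM lecR.
apply: le_trans (_ : g a x / G x * rnorm (f x - a) <= _).
  by rewrite ler_wpM2r ?rnorm_ge0// ler_piMl.
by rewrite mulrAC [leRHS]mulrAC ler_wpM2r.
Qed.

(** Testing on cutoffs [u] with a local unit [p] is enough. The relation
    [p u = u] is what later lets one write [u (x) a b] as the product of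
    [p (x) a] and [u (x) b]. *)
Theorem tens_dense (psi : dual (C0 X A)) :
  (forall (p u : cutoff R X) a, (forall x, p x * u x = u x) ->
     psi (tens u a) = 0) ->
  forall f, psi f = 0.
Proof.
move=> psi0 f; apply/eqP; rewrite -normr_le0.
apply: le_eps => // e e0; rewrite add0r.
have K0 : 0 < `|psi| + 1 by rewrite ltr_wpDl ?(normr_ge0 psi).
pose d := complex.Re (e / (`|psi| + 1)) / 3.
have d0 : 0 < d.
  by rewrite divr_gt0// -ltcR -ge0_ReE ?divr_gt0// ltW// divr_gt0.
have [p [s [u [pu fE]]]] := C0_approx f d0.
have sum0 : psi (\sum_(a <- s) tens (u a) a) = 0.
  have -> : psi (\sum_(a <- s) tens (u a) a) = \sum_(a <- s) psi (tens (u a) a).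
    exact: linear_sum.
  by apply: big1_seq => a /= sa; apply: (psi0 p) => x; exact: pu.
rewrite -[psi f]subr0 -sum0 -dual_appB.
apply: le_trans (dual_norm_ub psi _) _.
have -> : e = (`|psi| + 1) * (3 * d)%:C.
  have -> : 3 * d = complex.Re (e / (`|psi| + 1)) by rewrite /d mulrC divfK.
  rewrite -ge0_ReE ?divr_ge0 1?ltW// mulrC divfK//.
apply: ler_pM fE => //; last by rewrite lerDl.
exact: (normr_ge0 psi).
Qed.

End Density.

(** * Generalised limits and invariant means *)

Section Means.
Variable R : realType.
Local Open Scope complex_scope.

Definition bdd_fun (T : Type) (f : T -> (R[i])^o) :=
  exists M : R[i], forall t, `|f t| <= M.

Record mean (T : Type) := MkMean {
  mean_fun :> (T -> (R[i])^o) -> (R[i])^o;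
  mean_linear : forall k f g, bdd_fun f -> bdd_fun g ->
    mean_fun (fun t => k *: f t + g t) = k *: mean_fun f + mean_fun g;
  mean_le : forall f M, (forall t, `|f t| <= M) -> `|mean_fun f| <= M;
  mean_cst : forall c, mean_fun (fun=> c) = c
}.

Lemma ultra_cvg_real (T : Type) (U : set_system T) (f : T -> R) (M : R) :
  UltraFilter U -> (forall t, `|f t| <= M) -> exists l : R, f @ U --> l.
Proof.
move=> UU fM; have PU : ProperFilter U := ultra_proper.
have := @segment_compact R (- M) M; rewrite compact_ultra.
move=> /(_ (f @ U))[||l [_ fl]]; last by exists l.
  split=> [|G PG sG]; first exact: fmap_proper_filter.
  apply/seteqP; split=> // S GS; have [//|US] := in_ultra_setVsetC (f @^-1` S) UU.
  have := @filter_not_empty _ G PG; have -> : set0 = S `&` ~` S by rewrite setICr.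
  by case; apply: filterI => //; exact: sG.
apply: (@filterE _ U) => t; rewrite /= in_itv /= -ler_norml; exact: fM.
Qed.

Lemma ultra_cvg_complex (T : Type) (U : set_system T) (f : T -> (R[i])^o) :
  UltraFilter U -> bdd_fun f -> exists l : (R[i])^o, f @ U --> l.
Proof.
move=> UU [M fM]; have PU : ProperFilter U := ultra_proper.
have leM (z : R[i]) : `|z| <= M -> complex.Re `|z| <= complex.Re M.
  by move=> zM; rewrite -lecR -!ge0_ReE// (le_trans _ zM).
have [a fa] := @ultra_cvg_real T U (fun t => complex.Re (f t)) (complex.Re M) UU
  (fun t => le_trans (Re_le_norm _) (leM _ (fM t))).
have [b fb] := @ultra_cvg_real T U (fun t => complex.Im (f t)) (complex.Re M) UU
  (fun t => le_trans (Im_le_norm _) (leM _ (fM t))).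
exists (Complex a b); apply/cvgrPdist_lt => e e0.
have e2 : 0 < complex.Re e / 2.
  by rewrite divr_gt0// -ltcR -ge0_ReE// ltW.
move: fa fb => /cvgrPdist_lt/(_ _ e2) ha /cvgrPdist_lt/(_ _ e2) hb.
apply: filterS2 ha hb => y; case: (f y) => c d /= ha hb.
apply: le_lt_trans (norm_le_ReIm _) _.
by rewrite [ltRHS]ge0_ReE 1?ltW// ltcR/= (splitr (complex.Re e)) ltrD.
Qed.

(** Bounded functions converge along an ultrafilter refining [F]. *)
Lemma limit_mean (T : Type) (F : set_system T) : ProperFilter F ->
  exists m : mean T, forall f (l : (R[i])^o), f @ F --> l -> m f = l.
Proof.
move=> PF; have [U [UU FU]] := ultraFilterLemma PF.
have PU : ProperFilter U := ultra_proper.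
pose m (f : T -> (R[i])^o) : (R[i])^o := lim (f @ U).
have mE f (l : (R[i])^o) : f @ U --> l -> m f = l by move=> fl; exact: cvg_lim fl.
have bm f : bdd_fun f -> f @ U --> m f.
  by move=> bf; have [l fl] := ultra_cvg_complex UU bf; rewrite (mE _ _ fl).
have mlin k f g : bdd_fun f -> bdd_fun g ->
    m (fun t => k *: f t + g t) = k *: m f + m g.
  move=> bf bg; apply: mE; apply: cvgD; last exact: bm.
  by apply: cvgZl_tmp; exact: bm.
have mle f M : (forall t, `|f t| <= M) -> `|m f| <= M.
  move=> fM; have M0 : 0 <= M.
    by have [t _] := filter_ex (@filterT _ F _); exact: le_trans (fM t).
  apply: le_eps => // e e0.
  have /cvgrPdist_lt/(_ _ e0) := bm f (ex_intro _ M fM).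
  move=> /filter_ex[t /ltW mt]; rewrite -[m f](subrK (f t)) addrC.
  by apply: le_trans (ler_normD _ _) _; rewrite lerD.
have mcst c : m (fun=> c) = c by apply: mE; exact: cvg_cst.
exists (MkMean mlin mle mcst) => f l fl; apply: mE.
by apply: cvg_trans fl => S; exact: FU.
Qed.

(** Averaging over longer and longer orbit segments of more and more
    transformations yields, for commuting transformations, a mean that is
    invariant under all of them. *)
Lemma invariant_mean (T G : Type) (t0 : T) (act : G -> T -> T) :
  (forall s s' t, act s (act s' t) = act s' (act s t)) ->
  exists m : mean T, forall s f, bdd_fun f -> m (fun t => f (act s t)) = m f.
Proof.
move=> actC.
pose avg n s (f : T -> (R[i])^o) t : (R[i])^o :=
  n.+1%:R^-1 * \sum_(j < n.+1) f (iter j (act s) t).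
pose avgs n S f := foldr (avg n) f S.
have n0 n : 0 < n.+1%:R^-1 :> R[i] by rewrite invr_gt0.
have avg_le n s f M : (forall t, `|f t| <= M) -> forall t, `|avg n s f t| <= M.
  move=> fM t; rewrite /avg normrM gtr0_norm// ler_pdivrMl//.
  apply: le_trans (ler_norm_sum _ _ _) _.
  apply: (@le_trans _ _ (\sum_(j < n.+1) M)); first exact: ler_sum.
  by rewrite sumr_const card_ord mulr_natl.
have avg_lin n s k f g t : avg n s (fun t => k *: f t + g t) t =
    k *: avg n s f t + avg n s g t.
  rewrite /avg big_split /= -scaler_sumr mulrDr; congr (_ + _).
  by rewrite -[LHS]/(_ * (k * _)) mulrCA.
have avgs_le n S f M : (forall t, `|f t| <= M) -> forall t, `|avgs n S f t| <= M.
  by move=> fM; elim: S => //= s S; exact: avg_le.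
have avgs_lin n S k f g t : avgs n S (fun t => k *: f t + g t) t =
    k *: avgs n S f t + avgs n S g t.
  elim: S t => //= s S IH t; rewrite -avg_lin; congr (avg _ _ _ _).
  exact/funext.
have avg_shift n s s' f t :
    avg n s (fun t => f (act s' t)) t = avg n s f (act s' t).
  congr (_ * _); apply: eq_bigr => j _; congr f.
  by elim: (j : nat) => //= j' <-; exact: actC.
have avgs_shift n S s' f t :
    avgs n S (fun t => f (act s' t)) t = avgs n S f (act s' t).
  elim: S t => //= s S IH t; rewrite -avg_shift; congr (avg _ _ _ _).
  exact/funext.
(* The average over an orbit segment telescopes under a shift along it. *)
have avg_inv n s f M : (forall t, `|f t| <= M) ->
    forall t, `|avg n s f (act s t) - avg n s f t| <= 2 * M / n.+1%:R.
  move=> fM t; rewrite /avg -mulrBr normrM gtr0_norm// mulrC ler_wpM2r ?(ltW (n0 n))//.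
  under eq_bigr do rewrite -iterSr.
  rewrite -sumrB -(big_mkord xpredT
    (fun j => f (iter j.+1 (act s) t) - f (iter j (act s) t))).
  rewrite (telescope_sumr (fun j => f (iter j (act s) t)))//.
  by apply: le_trans (ler_normB _ _) _; rewrite mulr_natl mulr2n lerD.
have avgs_inv n S s f M : List.In s S -> (forall t, `|f t| <= M) ->
    forall t, `|avgs n S f (act s t) - avgs n S f t| <= 2 * M / n.+1%:R.
  move=> + fM; elim: S => //= s' S IH [-> t|/IH{}IH t].
    exact/avg_inv/avgs_le.
  rewrite -avg_shift -[_ - _]addrC -scaleN1r -avg_lin; apply: avg_le => {}t.
  by rewrite scaleN1r addrC.
(* Later indices average over more transformations and longer segments. *)
pose B (i : seq G * nat) : set (seq G * nat) :=
  [set j | (forall s, List.In s i.1 -> List.In s j.1) /\ (i.2 <= j.2)%N].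
have PB : ProperFilter (filter_from setT B).
  apply: filter_from_proper => [|i _]; last by exists i; split.
  apply: filter_from_filter; first by exists ([::], 0%N).
  move=> i j _ _; exists (i.1 ++ j.1, maxn i.2 j.2) => // k /= [kS].
  rewrite geq_max => /andP[ik jk].
  by split; split=> // s sS; apply: kS; apply: List.in_or_app; [left|right].
have [m mF] := limit_mean PB.
pose m' (f : T -> (R[i])^o) := m (fun i : seq G * nat => avgs i.2 i.1 f t0).
have bm f : bdd_fun f -> bdd_fun (fun i : seq G * nat => avgs i.2 i.1 f t0).
  by move=> [M fM]; exists M => i; exact: avgs_le.
have mlin k f g : bdd_fun f -> bdd_fun g ->
    m' (fun t => k *: f t + g t) = k *: m' f + m' g.
  move=> bf bg; rewrite /m' -mean_linear; [|exact: bm|exact: bm].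
  by congr (mean_fun m _); apply/funext => i; exact: avgs_lin.
have mle f M : (forall t, `|f t| <= M) -> `|m' f| <= M.
  by move=> fM; apply: mean_le => i; exact: avgs_le.
have mcst c : m' (fun=> c) = c.
  rewrite -[RHS](mean_cst m); congr (mean_fun m _); apply/funext => -[S n] /=.
  suff: avgs n S (fun=> c) = (fun=> c) by move->.
  elim: S => //= s S ->; apply/funext => t; rewrite /avg sumr_const card_ord.
  by rewrite -[c *+ _]mulr_natl mulKf// pnatr_eq0.
exists (MkMean mlin mle mcst) => s f [M fM] /=.
have bfs : bdd_fun (fun t => f (act s t)) by exists M => t.
apply/eqP; rewrite -subr_eq0; apply/eqP.
have -> : m' (fun t => f (act s t)) - m' f =
    m (fun i : seq G * nat => -1 *: avgs i.2 i.1 f t0 +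
       avgs i.2 i.1 (fun t => f (act s t)) t0).
  rewrite mean_linear; [|by apply: bm; exists M|exact: bm].
  by rewrite scaleN1r addrC.
apply: mF; apply/cvgrPdist_lt => e e0.
have M0 : 0 <= M := le_trans (normr_ge0 _) (fM t0).
have K0 : 0 <= 2 * M / e by rewrite divr_ge0 ?mulr_ge0// ltW.
have [n1 n1P] := lt_some_nat K0.
exists ([:: s], n1) => // -[S n] /= [sS n1n].
rewrite sub0r normrN scaleN1r addrC avgs_shift.
apply: le_lt_trans (avgs_inv n S s f M _ fM t0) _; first by apply: sS; left.
rewrite ltr_pdivrMr ?ltr0n// [e * _]mulrC -ltr_pdivrMr//.
by apply: lt_le_trans n1P _; rewrite ler_nat.
Qed.

End Means.

(** * A virtual diagonal for [C0 X A] *)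

Section BilMul.
Variables (R : realType) (A : banachAlgType R).
Implicit Types (f : bil A A) (c : A).

Definition bil_lmul c f : bil A A := MkBil (diff_ract_subproof f c).

Lemma bil_rmul_subproof f c : (fun b a => f b (bmul a c)) \in @bil_pred R A A.
Proof.
apply/asboolP; split=> [a k x y|b k x y|].
- by rewrite bilDl bilZl.
- by rewrite bmulDl -bscalerAl bilDr bilZr.
- exists (`|f| * `|c|) => [|b a]; first by rewrite mulr_ge0 ?(normr_ge0 f).
  apply: le_trans (bil_norm_ub f _ _) _; rewrite -mulrA.
  by rewrite ler_wpM2l ?(normr_ge0 f)// mulrCA ler_wpM2l// mulrC bnormM.
Qed.

Definition bil_rmul f c : bil A A := MkBil (bil_rmul_subproof f c).

Lemma bil_lmul_linear f : linear (bil_lmul^~ f).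
Proof.
by move=> k c d; apply: bil_ext => b a; rewrite /= bmulDl -bscalerAl bilDl bilZl.
Qed.

Lemma bil_rmul_linear f : linear (bil_rmul f).
Proof.
by move=> k c d; apply: bil_ext => b a; rewrite /= bmulDr -bscalerAr bilDr bilZr.
Qed.

Lemma bil_lmul_norm f c : `|bil_lmul c f| <= `|f| * `|c|.
Proof.
apply: bil_norm_le => [|b a]; first by rewrite mulr_ge0 ?(normr_ge0 f).
apply: le_trans (bil_norm_ub f _ _) _; rewrite -mulrA.
by rewrite ler_wpM2l ?(normr_ge0 f)// mulrA ler_wpM2r// bnormM.
Qed.

Lemma bil_rmul_norm f c : `|bil_rmul f c| <= `|f| * `|c|.
Proof.
apply: bil_norm_le => [|b a]; first by rewrite mulr_ge0 ?(normr_ge0 f).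
apply: le_trans (bil_norm_ub f _ _) _; rewrite -mulrA.
by rewrite ler_wpM2l ?(normr_ge0 f)// mulrCA ler_wpM2l// mulrC bnormM.
Qed.

End BilMul.

Section UnimodularGroup.
Variables (R : realType) (X : topologicalType).

Record unim := MkUnim { um :> mult R X; umP : unimodular um }.

Lemma um_ext (v w : unim) : v =1 w -> v = w.
Proof.
case: v w => [v vP] [w wP] /= /mult_ext vw; subst w.
by congr MkUnim; exact: Prop_irrelevance.
Qed.

Lemma um_neq0 (w : unim) x : w x != 0.
Proof. by rewrite -normr_gt0 umP. Qed.

Lemma um_mul_subproof (v w : unim) : unimodular (mult_mul v w).
Proof. by move=> x; rewrite /= normrM !umP mulr1. Qed.

Definition um_mul v w := MkUnim (um_mul_subproof v w).

Lemma um_inv_subproof (w : unim) :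
  continuous (fun x => (w x)^-1 : (R[i])^o) /\ forall x, `|(w x)^-1| <= 1.
Proof.
split=> x; last by rewrite normfV umP invr1.
by apply: (@cvgV R[i]); [exact: um_neq0|exact: mult_continuous].
Qed.

Definition um_inv (w : unim) : mult R X :=
  MkMult (um_inv_subproof w).1 (um_inv_subproof w).2.

Lemma um_one_subproof : unimodular (mult_one R X).
Proof. by move=> x; rewrite /= normr1. Qed.

Definition um_one := MkUnim um_one_subproof.

Lemma um_mulCA (u v w : unim) : um_mul u (um_mul v w) = um_mul v (um_mul u w).
Proof.
by apply: um_ext => x; rewrite /= mulrCA.
Qed.

Lemma cutoff_um (p : cutoff R X) : exists v v' : unim,
  forall x, cutoff_mult p x = 2^-1 * (v x + v' x).
Proof.
have [v [v' [vu v'u _ pE]]] := cutoff_unimodular p.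
by exists (MkUnim vu), (MkUnim v'u).
Qed.

(** Limits along the cutoffs: a cutoff is later when it is larger. *)
Lemma cutoff_mean : exists m : mean R (cutoff R X),
  forall f c (p0 : cutoff R X),
    (forall p : cutoff R X, (forall x, p0 x <= p x) -> f p = c) -> m f = c.
Proof.
pose B (q : cutoff R X) : set (cutoff R X) := [set p | forall x, q x <= p x].
have [p00 _] : exists p : cutoff R X, True.
  have v e : 0 < e -> exists2 K : set X, compact K & forall x, ~ K x -> 0 < e :> R.
    by move=> e0; exists set0; [exact: compact0|].
  by exists (@MkCutoff R X (fun=> 0) (fun x => cvg_cst _) (fun=> lexx 0)
    (fun=> ler01) v).
have PB : ProperFilter (filter_from setT B).
  apply: filter_from_proper => [|q _]; last by exists q => x.
  apply: filter_from_filter; first by exists p00.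
  move=> p q _ _; have [r rE] := cutoff_max_exists p q; exists r => // s rs.
  by split=> x; apply: le_trans (rs x); rewrite rE le_max lexx ?orbT.
have [m mF] := limit_mean R PB.
exists m => f c p0 fc; apply: mF.
apply: cvg_near_cst; exists p0 => // p; exact: fc.
Qed.

End UnimodularGroup.

Section C0VirtualDiagonal.
Variables (R : realType) (X : topologicalType) (A : banachAlgType R).
Variables (M : dual (bil A A)) (vdM : virtual_diagonal M).
Local Notation B := (C0 X A).
Implicit Types (p u : cutoff R X) (f : bil B B) (v w : mult R X).

Lemma form_subproof f p v w :
  (fun a b => f (mult_act v (tens p a)) (mult_act w (tens p b)))
    \in @bil_pred R A A.
Proof.
apply/asboolP; split=> [b k x y|a k x y|].
- by rewrite tens_linear mult_act_linear bilDl bilZl.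
- by rewrite tens_linear mult_act_linear bilDr bilZr.
- exists `|f| => // a b; apply: le_trans (bil_norm_ub f _ _) _.
  rewrite ler_wpM2l ?(normr_ge0 f)//; apply: ler_pM => //.
    exact: le_trans (mult_act_norm _ _) (tens_norm _ _).
  exact: le_trans (mult_act_norm _ _) (tens_norm _ _).
Qed.

Definition form f p v w : bil A A := MkBil (form_subproof f p v w).

Lemma form_norm f p v w : `|form f p v w| <= `|f|.
Proof.
apply: bil_norm_le => // a b; apply: le_trans (bil_norm_ub f _ _) _.
rewrite ler_wpM2l ?(normr_ge0 f)//; apply: ler_pM => //.
  exact: le_trans (mult_act_norm _ _) (tens_norm _ _).
exact: le_trans (mult_act_norm _ _) (tens_norm _ _).
Qed.

Lemma form_lmul u c f p v w :
  form (bil_lmul (tens u c) f) p v w =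
  bil_lmul c (form f p (mult_mul (cutoff_mult u) v) w).
Proof.
apply: bil_ext => a b /=; congr (bil_fun f _ _).
by apply: C0_ext => x /=; rewrite -bscalerAl -!bscalerAr !scalerA.
Qed.

Lemma form_rmul u c f p v w :
  form (bil_rmul f (tens u c)) p v w =
  bil_rmul (form f p v (mult_mul (cutoff_mult u) w)) c.
Proof.
apply: bil_ext => a b /=; congr (bil_fun f _ _).
by apply: C0_ext => x /=; rewrite -bscalerAr -!bscalerAl !scalerA.
Qed.

Lemma form_halfl f p (u v v' w w2 : mult R X) :
  (forall x, u x = 2^-1 * (v x + v' x)) ->
  form f p (mult_mul u w) w2 =
  2^-1 *: form f p (mult_mul v w) w2 + 2^-1 *: form f p (mult_mul v' w) w2.
Proof.
move=> uE; apply: bil_ext => a b.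
rewrite -[RHS]/(2^-1 *: f _ _ + 2^-1 *: f _ _) -!bilZl -bilDl.
congr (bil_fun f _ _); apply: C0_ext => x.
rewrite -[RHS]/(2^-1 *: (mult_mul v w x *: tens p a x) +
                2^-1 *: (mult_mul v' w x *: tens p a x)).
by rewrite /= uE !scalerA -scalerDl; congr (_ *: _); ring.
Qed.

Lemma form_halfr f p (u v v' w w1 : mult R X) :
  (forall x, u x = 2^-1 * (v x + v' x)) ->
  form f p w1 (mult_mul u w) =
  2^-1 *: form f p w1 (mult_mul v w) + 2^-1 *: form f p w1 (mult_mul v' w).
Proof.
move=> uE; apply: bil_ext => a b.
rewrite -[RHS]/(2^-1 *: f _ _ + 2^-1 *: f _ _) -!bilZr -bilDr.
congr (bil_fun f _ _); apply: C0_ext => x.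
rewrite -[RHS]/(2^-1 *: (mult_mul v w x *: tens p b x) +
                2^-1 *: (mult_mul v' w x *: tens p b x)).
by rewrite /= uE !scalerA -scalerDl; congr (_ *: _); ring.
Qed.

Lemma form_linear p v w : linear (fun f => form f p v w).
Proof. by move=> k f g; apply: bil_ext. Qed.

(** The diagonal of [C0 X] is the limit over cutoffs [p] of the average of
    [w p (x) w^-1 p] over the unimodular functions [w]; it is combined with the
    diagonal [M] of [A]. To move [u (x) c] across, [M] moves [c] and the
    invariance of the average moves [u], a half-sum of two unimodular
    functions. By density this suffices. *)
Theorem C0_virtual_diagonal : exists N : dual (bil B B), virtual_diagonal N.
Proof.
have [lim_p lim_pE] := cutoff_mean R X.
have [mu mu_inv] := invariant_mean R (um_one R X) (@um_mulCA R X).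
pose F f p (w : unim R X) := M (form f p w (um_inv w)).
have F_le f p (w : unim R X) : `|F f p w| <= `|M| * `|f|.
  apply: le_trans (dual_norm_ub M _) _.
  by rewrite ler_wpM2l ?(normr_ge0 M) ?form_norm.
have bF f p : bdd_fun (F f p) by exists (`|M| * `|f|) => w; exact: F_le.
have bmu f : bdd_fun (fun p => mu (F f p)).
  by exists (`|M| * `|f|) => p; apply: mean_le => w; exact: F_le.
have [||N NE] := @dual_exists R (bil B B) (fun f => lim_p (fun p => mu (F f p))).
- move=> k f g; rewrite -mean_linear//; congr (mean_fun lim_p _).
  apply/funext => p; rewrite -mean_linear//; congr (mean_fun mu _).
  by apply/funext => w; rewrite /F form_linear dual_linear.
- by exists `|M| => f; apply: mean_le => p; apply: mean_le => w; exact: F_le.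
have [comm unit] := vdM.
exists N; split=> [h f f1 f2 f1E f2E|h psi f fE].
- have -> : f1 = bil_lmul h f by exact: bil_ext.
  have -> : f2 = bil_rmul f h by exact: bil_ext.
  apply/eqP; rewrite -subr_eq0; apply/eqP; move: h {f1 f2 f1E f2E}.
  have [||d dE] := @dual_exists R B (fun h => N (bil_lmul h f) - N (bil_rmul f h)).
  + move=> k g h; rewrite bil_lmul_linear bil_rmul_linear !dual_linear.
    by rewrite scalerBr opprD addrACA.
  + exists (`|N| * `|f| + `|N| * `|f|) => h.
    rewrite mulrDl (le_trans (ler_normB _ _))// lerD//.
      apply: le_trans (dual_norm_ub N _) _; rewrite -mulrA.
      by rewrite ler_wpM2l ?(normr_ge0 N) ?bil_lmul_norm.
    apply: le_trans (dual_norm_ub N _) _; rewrite -mulrA.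
    by rewrite ler_wpM2l ?(normr_ge0 N) ?bil_rmul_norm.
  move=> h; rewrite -dE; apply: tens_dense => _ u c _; rewrite dE.
  apply/eqP; rewrite subr_eq0 !NE; apply/eqP; congr (mean_fun lim_p _).
  apply/funext => p; have [v [v' vE]] := cutoff_um u.
  pose Q (w1 w2 : mult R X) := M (bil_rmul (form f p w1 w2) c).
  have bQ (T : Type) (w1 w2 : T -> mult R X) : bdd_fun (fun t => Q (w1 t) (w2 t)).
    exists (`|M| * (`|f| * `|c|)) => t; apply: le_trans (dual_norm_ub M _) _.
    rewrite ler_wpM2l ?(normr_ge0 M)//; apply: le_trans (bil_rmul_norm _ _) _.
    by rewrite ler_wpM2r// form_norm.
  have Q_lin (g g1 g2 : bil A A) : g = 2^-1 *: g1 + 2^-1 *: g2 ->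
      M (bil_rmul g c) = 2^-1 *: M (bil_rmul g1 c) + 2^-1 *: M (bil_rmul g2 c).
    move=> ->; rewrite -!dual_appZ -dual_appD; congr (dual_fun M _).
    exact: bil_ext.
  have -> : F (bil_lmul (tens u c) f) p = fun w : unim R X =>
      2^-1 *: Q (um_mul v w) (um_inv w) + 2^-1 *: Q (um_mul v' w) (um_inv w).
    apply/funext => w; rewrite /F form_lmul.
    set g := form f p _ _; rewrite (comm c g _ (bil_rmul g c))//.
    by apply: Q_lin; exact: form_halfl.
  have -> : F (bil_rmul f (tens u c)) p = fun w : unim R X =>
      2^-1 *: Q w (mult_mul v (um_inv w)) + 2^-1 *: Q w (mult_mul v' (um_inv w)).
    apply/funext => w; rewrite /F form_rmul.
    by apply: Q_lin; exact: form_halfr.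
  have bQZ (w1 w2 : unim R X -> mult R X) : bdd_fun (fun t => 2^-1 *: Q (w1 t) (w2 t)).
    have [K QK] := bQ _ w1 w2; exists (`|2^-1 : R[i]| * K) => t.
    by rewrite normrM ler_wpM2l.
  rewrite !mean_linear; [|exact: bQ|exact: bQZ|exact: bQ|exact: bQZ].
  have muZ (g : unim R X -> (R[i])^o) : bdd_fun g ->
      mu (fun w : unim R X => 2^-1 *: g w) = 2^-1 *: mu g.
    move=> bg; have b0 : bdd_fun (fun _ : unim R X => 0 : (R[i])^o).
      by exists 0 => t; rewrite normr0.
    have := @mean_linear _ _ mu 2^-1 g (fun=> 0) bg b0.
    rewrite mean_cst addr0 => <-; congr (mean_fun mu _).
    by apply/funext => w; rewrite addr0.
  rewrite !muZ; [|exact: bQ..].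
  (* Substitute [z w] for [w]. *)
  have shift (z : unim R X) : mu (fun w : unim R X => Q (um_mul z w) (um_inv w)) =
      mu (fun w : unim R X => Q w (mult_mul z (um_inv w))).
    rewrite -(mu_inv z (fun w : unim R X => Q w (mult_mul z (um_inv w)))); last first.
      exact: bQ.
    congr (mean_fun mu _); apply/funext => w; congr (Q _ _).
    by apply: mult_ext => x; rewrite /= invfM mulVKf// um_neq0.
  by rewrite !shift.
- have -> : f = mul_form (dual_ract (E := regular_bimod B) psi h).
    exact: bil_ext.
  apply/eqP; rewrite -subr_eq0; apply/eqP; move: h {f fE}.
  pose g h := mul_form (dual_ract (E := regular_bimod B) psi h).
  have [||d dE] := @dual_exists R B (fun h => N (g h) - psi h).
  + move=> k x y; rewrite /g dual_ractDr dual_ractZr mul_form_linear !dual_linear.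
    by rewrite scalerBr opprD addrACA.
  + exists (`|N| * `|psi| + `|psi|) => h.
    rewrite mulrDl (le_trans (ler_normB _ _))// lerD ?dual_norm_ub//.
    apply: le_trans (dual_norm_ub N _) _; rewrite -mulrA.
    rewrite ler_wpM2l ?(normr_ge0 N)//; apply: le_trans (mul_form_norm _) _.
    apply: dual_norm_le => [|x]; first by rewrite mulr_ge0 ?(normr_ge0 psi).
    apply: le_trans (dual_norm_ub psi _) _; rewrite -mulrA.
    by rewrite ler_wpM2l ?(normr_ge0 psi)// bnormM.
  move=> h; rewrite -dE; apply: tens_dense => p0 u c p0u; rewrite dE.
  apply/eqP; rewrite subr_eq0 NE; apply/eqP; apply: (lim_pE _ _ p0) => p p0p.
  rewrite -[RHS](mean_cst mu); congr (mean_fun mu _); apply/funext => w.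
  have [psiu psiuE] : exists psiu : dual A, forall a, psiu a = psi (tens u a).
    apply: dual_exists => [k x y|]; first by rewrite tens_linear dual_linear.
    exists `|psi| => a; apply: le_trans (dual_norm_ub psi _) _.
    by rewrite ler_wpM2l ?(normr_ge0 psi)// tens_norm.
  rewrite -psiuE; apply: unit => a b; rewrite psiuE.
  rewrite -[LHS]/(psi (bmul (tens u c) (bmul (mult_act w (tens p a))
    (mult_act (um_inv w) (tens p b))))).
  congr (dual_fun psi _); apply: C0_ext => x /=.
  rewrite !(=^~ bscalerAl, =^~ bscalerAr) !scalerA; congr (_ *: _).
  (* Where [u] does not vanish, [p >= p0 = 1]. *)
  have pu : (u x)%:C%C * ((p x)%:C%C * (p x)%:C%C) = (u x)%:C%C.
    rewrite -!rmorphM /=; congr (_%:C%C).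
    have [->|u0] := eqVneq (u x) 0; first by rewrite mul0r.
    have p01 : p0 x = 1 by apply: (mulIf u0); rewrite mul1r p0u.
    have -> : p x = 1; last by rewrite !mulr1.
    by apply/eqP; rewrite eq_le cutoff_le1 -p01 p0p.
  rewrite -[RHS]pu -[X in _ = X]mul1r -(divff (um_neq0 w x)).
  ring.
Qed.

End C0VirtualDiagonal.

(** * Quotients *)

Lemma weakly_amenable_inner (R : realType) (A : banachAlgType R)
    (D : A -> dual (regular_bimod A)) (K : R[i]) :
  weakly_amenable A ->
  linear D -> (forall a, `|D a| <= K * `|a|) -> derivation D -> inner D.
Proof.
move=> wA lD DK dD.
pose lD' := GRing.isLinear.Build R[i] A (dual (regular_bimod A)) _ D lD.
pose D' : {linear A -> dual (regular_bimod A)} := HB.pack D lD'.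
exact: (wA D' (continuous_of_bounded (f := D') DK) dD).
Qed.

Lemma inner_commutative (R : realType) (A : banachAlgType R)
    (D : A -> dual (regular_bimod A)) :
  (forall a b : A, bmul a b = bmul b a) -> inner D -> forall a, D a = 0.
Proof.
move=> cA [z zD] a; rewrite zD; apply: dual_ext => b.
by rewrite -[LHS]/(z (bmul b a) - z (bmul a b)) cA subrr.
Qed.

Section Quotient.
Variables (R : realType) (B A : banachAlgType R) (h : {linear B -> A}).
Hypothesis hM : forall a b, h (bmul a b) = bmul (h a) (h b).
Hypothesis h1 : forall b, `|h b| <= `|b|.
Hypothesis h_surj : forall a, exists b, h b = a.

Lemma amenable_quotient : amenable B -> amenable A.
Proof.
move=> amB E D cD dD; have [K K0 DK] := bounded_of_continuous cD.
have [|||z zD] := @amenable_inner R B amB (pullback_bimod hM h1 E) (D \o h) K.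
- by move=> k x y; rewrite /= !linearP.
- by move=> b; apply: le_trans (DK (h b)) _; rewrite ler_wpM2l.
- by move=> x y; rewrite /= hM dD; apply: dual_ext.
by exists z => a; have [b <-] := h_surj a; have /= -> := zD b; apply: dual_ext.
Qed.

Lemma point_amenable0_quotient : point_amenable0 B -> point_amenable0 A.
Proof.
move=> pB phi chi d cd pd a; have [b <-] := h_surj a.
have [K K0 dK] := bounded_of_continuous cd.
apply: (pB (phi \o h : {linear B -> (R[i])^o}) _ (d \o h : {linear B -> (R[i])^o})).
- case: chi => [[phiM [x x0]]|phi0]; [left|right] => [|y]; last exact: phi0.
  split=> [y z|]; first by rewrite /= hM phiM.
  by have [y yx] := h_surj x; exists y; rewrite /= yx.
- apply: (continuous_of_bounded (M := K)) => y /=.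
  by apply: le_trans (dK _) _; rewrite ler_wpM2l.
- by move=> y z; rewrite /= hM pd.
Qed.

(** The composite [B -> A -> dual A -> dual B] is an inner derivation, so it
    vanishes, and [h] is onto. *)
Lemma weakly_amenable_quotient : (forall a b : B, bmul a b = bmul b a) ->
  weakly_amenable B -> weakly_amenable A.
Proof.
move=> cB wB D cD dD; have [K K0 DK] := bounded_of_continuous cD.
have D'_subproof b : (fun c => D (h b) (h c)) \in @dual_pred R (regular_bimod B).
  apply: (@dual_predP _ _ _ `|D (h b)|) => [k x y|x].
    by rewrite linearP dual_linear.
  apply: le_trans (dual_norm_ub (D (h b)) _) _.
  by rewrite ler_wpM2l ?(normr_ge0 (D (h b)))// h1.
pose D' b : dual (regular_bimod B) := MkDual (D'_subproof b).
have innerD' : inner D'.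
  apply: (weakly_amenable_inner (K := K) wB).
  - by move=> k x y; apply: dual_ext => c; rewrite /= !linearP.
  - move=> b; apply: dual_norm_le => [|c]; first by rewrite mulr_ge0.
    apply: le_trans (dual_norm_ub (D (h b)) _) _; apply: ler_pM => //.
    + exact: (normr_ge0 (D (h b))).
    + by apply: le_trans (DK (h b)) _; rewrite ler_wpM2l.
    + exact: h1.
  - move=> x y; apply: dual_ext => c; rewrite /= hM dD.
    by rewrite -[RHS]/(D (h x) (h (bmul y c)) + D (h y) (h (bmul c x))) !hM.
have D'0 := inner_commutative cB innerD'.
exists 0 => a; have [b <-] := h_surj a; apply: dual_ext => c.
have [c' <-] := h_surj c; rewrite -[LHS]/(D' b c') D'0.
by rewrite -[RHS]/(0 - 0 : (R[i])^o) subr0.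
Qed.

End Quotient.

Section Evaluation.
Variables (R : realType) (X : topologicalType) (A : banachAlgType R) (x0 : X).

Definition C0_eval (f : C0 X A) : A := f x0.

Lemma C0_eval_linear : linear C0_eval. Proof. by []. Qed.

HB.instance Definition _ :=
  GRing.isLinear.Build R[i] (C0 X A) A _ C0_eval C0_eval_linear.

Lemma C0_eval_norm f : `|C0_eval f| <= `|f|.
Proof. exact: C0_norm_ub. Qed.

Lemma C0_eval_surj : hausdorff_space X -> locally_compact [set: X] ->
  forall a, exists f, C0_eval f = a.
Proof.
move=> hX lX a; have [p p1] := @cutoff_at R X x0 hX lX.
by exists (tens p a); rewrite /C0_eval /= p1 scale1r.
Qed.

End Evaluation.

(** * Point derivations on [C0 X A] *)

Section LocalUnits.
Variables (R : realType) (X : topologicalType) (A : banachAlgType R).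
Implicit Types (p u : cutoff R X) (a b : A).

Lemma tens_unitM p u a b : (forall x, p x * u x = u x) ->
  bmul (tens p a) (tens u b) = tens u (bmul a b).
Proof.
by move=> pu; rewrite tensM; apply: C0_ext => x; rewrite /= cutoff_mulE pu.
Qed.

Lemma tens_actE p u a : (forall x, p x * u x = u x) ->
  mult_act (cutoff_mult u) (tens p a) = tens u a.
Proof.
move=> pu; rewrite cutoff_actE; apply: C0_ext => x.
by rewrite /= cutoff_mulE mulrC pu.
Qed.

Lemma dual_tens (psi : dual (C0 X A)) u :
  exists f : dual A, forall a, f a = psi (tens u a).
Proof.
apply: dual_exists => [k x y|]; first by rewrite tens_linear dual_linear.
exists `|psi| => a; apply: le_trans (dual_norm_ub psi _) _.
by rewrite ler_wpM2l ?(normr_ge0 psi)// tens_norm.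
Qed.

Lemma act_halves (u v v' : mult R X) (f : C0 X A) :
  (forall x, u x = 2^-1 * (v x + v' x)) ->
  mult_act u f = 2^-1 *: (mult_act v f + mult_act v' f).
Proof.
move=> uE; apply: C0_ext => x.
rewrite -[RHS]/(2^-1 *: (v x *: f x + v' x *: f x)) /= uE.
by rewrite -scalerDl scalerA.
Qed.

Definition mult_pow (v : mult R X) n := iter n (mult_mul v) (mult_one R X).

Lemma mult_pow_inv (v : unim R X) n :
  exists w : mult R X, forall f : C0 X A, mult_act (mult_pow v n) (mult_act w f) = f.
Proof.
exists (iter n (mult_mul (um_inv v)) (mult_one R X)) => f.
apply: C0_ext => x; rewrite /= scalerA -[RHS]scale1r; congr (_ *: _).
elim: n => [|n IH] /=; first by rewrite mulr1.
by rewrite mulrACA IH mulr1 divff ?um_neq0.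
Qed.

Lemma linear_growth0 (eta C : R[i]) :
  (forall n : nat, n%:R * `|eta| <= C) -> eta = 0.
Proof.
move=> H; apply/eqP; rewrite -normr_le0; apply: le_eps => // e e0.
have C0 : 0 <= C by have := H 0; rewrite mul0r.
have Ce : 0 <= C / e by rewrite divr_ge0// ltW.
have [n Cn] := lt_some_nat Ce.
rewrite add0r -(ler_pM2l (ltr0Sn R[i] n)); apply: le_trans (H _) _.
by rewrite -ler_pdivrMr// ltW.
Qed.

End LocalUnits.

Section PointDerivation.
Variables (R : realType) (A : banachAlgType R).
Hypothesis pA : point_amenable0 A.

Lemma point_derivation0 (phi : A -> (R[i])^o) (d : dual A) :
  linear phi -> (forall a b, phi (bmul a b) = phi a * phi b) ->
  (forall a b, d (bmul a b) = phi a * d b + phi b * d a) -> forall a, d a = 0.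
Proof.
move=> lphi phiM pd.
pose lphi' := GRing.isLinear.Build R[i] A (R[i])^o _ phi lphi.
pose phi' : {linear A -> (R[i])^o} := HB.pack phi lphi'.
have chi : character phi' \/ (forall a, phi' a = 0).
  have [[a a0]|na] := pselect (exists a, phi a != 0); [left|right] => //.
    by split=> //; exists a.
  by move=> a; apply/eqP/negPn/negP => a0; apply: na; exists a.
by apply: (pA chi (d := d : {linear A -> (R[i])^o})) => //; exact: dual_continuous.
Qed.

Variable X : topologicalType.
Local Notation B := (C0 X A).
Implicit Types (p u : cutoff R X) (m n : mult R X) (f g : B).

(** At the zero functional a point derivation kills products, hence kills
    [u (x) a b = (p (x) a) (u (x) b)]. *)
Lemma C0_zero_derivation (d : dual B) :
  (forall f g, d (bmul f g) = 0) -> forall f, d f = 0.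
Proof.
move=> dM; apply: tens_dense => p u a pu.
have [da daE] := dual_tens d u; rewrite -daE.
apply: (@point_derivation0 (fun=> 0)) => [k x y|x y|x y].
- by rewrite scaler0 addr0.
- by rewrite mulr0.
- by rewrite !mul0r addr0 daE -(tens_unitM x y pu) dM.
Qed.

Section AtCharacter.
Variables (phi : {linear B -> (R[i])^o}) (d : dual B) (f0 : B).
Hypothesis phiM : forall f g, phi (bmul f g) = phi f * phi g.
Hypothesis phi1 : phi f0 = 1.
Hypothesis dM : forall f g, d (bmul f g) = phi f * d g + phi g * d f.

(* [r] extends the character [phi] to the multipliers. *)
Let r m := phi (mult_act m f0).

Let phi_act m f : phi (mult_act m f) = r m * phi f.
Proof.
rewrite mulrC -phiM mult_actMr -mult_actMl phiM phi1.
by rewrite mulr1.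
Qed.

Let rM m n : r (mult_mul m n) = r m * r n.
Proof. by rewrite /r mult_actM phi_act. Qed.

Let r1 : r (mult_one R X) = 1.
Proof.
rewrite -[RHS]phi1; congr (phi _); apply: C0_ext => x.
by rewrite /= scale1r.
Qed.

(* The spectrum of a unimodular function lies on the unit circle: otherwise
   [r v - v] would be invertible among the multipliers. *)
Let r_um (v : unim R X) : `|r v| = 1.
Proof.
apply/eqP; apply: contraT => rv.
have rv0 : `|r v| - 1 != 0 by rewrite subr_eq0.
pose c := `| `|r v| - 1 |.
have c0 : 0 < c by rewrite normr_gt0.
have cx x : c <= `|r v - v x|.
  by rewrite /c -(umP v x); exact: ler_dist_dist.
have ne0 x : r v - v x != 0 by rewrite -normr_gt0 (lt_le_trans c0).
have km : continuous (fun x => c / (r v - v x) : (R[i])^o) /\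
    forall x, `|c / (r v - v x)| <= 1.
  split=> x; last first.
    by rewrite normrM normfV (gtr0_norm c0) ler_pdivrMr ?mul1r ?(lt_le_trans c0).
  apply: (@cvgM R[i]); first exact: cvg_cst.
  apply: (@cvgV R[i]) => //; apply: cvgB; first exact: cvg_cst.
  exact: mult_continuous.
pose k := MkMult km.1 km.2.
have /eqP : phi (mult_act k (r v *: f0 - mult_act v f0)) = 0.
  rewrite phi_act linearB linearZ /= phi1 -[r v *: 1]/(r v * 1) mulr1.
  by rewrite subrr mulr0.
have -> : mult_act k (r v *: f0 - mult_act v f0) = c *: f0.
  apply: C0_ext => x.
  rewrite -[LHS]/(k x *: (r v *: f0 x - v x *: f0 x)) -scalerBl scalerA.
  by rewrite /= divfK.
by rewrite linearZ /= phi1 -[c *: 1]/(c * 1) mulr1 gt_eqF.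
Qed.

(* [eta] is a point derivation at [r] on the multipliers; along the powers of
   a unimodular function it grows linearly and stays bounded, so it vanishes. *)
Let eta m := d (mult_act m f0) - r m * d f0.

Let d_act m f : d (mult_act m f) = r m * d f + phi f * eta m.
Proof.
have := dM f (mult_act m f0).
rewrite mult_actMr -mult_actMl dM phi1 phi_act -/(r m) mul1r => /esym/eqP.
rewrite [X in _ == X]addrC -subr_eq => /eqP <-.
by rewrite /eta mulrBr; ring.
Qed.

Let etaM m n : eta (mult_mul m n) = r m * eta n + r n * eta m.
Proof. by rewrite /eta mult_actM d_act rM /eta -/(r n); ring. Qed.

Let eta1 : eta (mult_one R X) = 0.
Proof.
rewrite /eta r1 mul1r; apply/eqP; rewrite subr_eq0; apply/eqP.
by congr (dual_fun d _); apply: C0_ext => x; rewrite /= scale1r.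
Qed.

Let eta_um (v : unim R X) : eta v = 0.
Proof.
have rpow k : r (mult_pow v k) = r v ^+ k.
  by elim: k => [|k IH]; rewrite ?r1//= rM -/(mult_pow v k) IH exprS.
have etapow k : eta (mult_pow v k.+1) = k.+1%:R * r v ^+ k * eta v.
  elim: k => [|k IH].
    by rewrite /= etaM eta1 mulr0 add0r r1 !mul1r.
  rewrite -[mult_pow v k.+2]/(mult_mul v (mult_pow v k.+1)) etaM IH rpow.
  by rewrite [k.+2%:R]mulrSr !exprS; ring.
apply: (@linear_growth0 _ _ (`|d| * `|f0| + `|d| * `|f0|)) => -[|k].
  by rewrite mul0r addr_ge0 ?mulr_ge0 ?(normr_ge0 d).
have -> : k.+1%:R * `|eta v| = `|eta (mult_pow v k.+1)|.
  by rewrite etapow !normrM normrX r_um expr1n mulr1 normr_nat.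
apply: le_trans (ler_normB _ _) _; rewrite lerD//.
  apply: le_trans (dual_norm_ub d _) _.
  by rewrite ler_wpM2l ?(normr_ge0 d) ?mult_act_norm.
by rewrite normrM rpow normrX r_um expr1n mul1r dual_norm_ub.
Qed.

Let d_cutoff u f : d (mult_act (cutoff_mult u) f) = r (cutoff_mult u) * d f.
Proof.
have [v [v' uE]] := cutoff_um u.
rewrite (act_halves f uE) dual_appZ dual_appD !d_act !eta_um !mulr0 !addr0.
have -> : r (cutoff_mult u) = 2^-1 * (r v + r v').
  by rewrite /r (act_halves f0 uE) linearZ linearD.
by rewrite -mulrDl; exact: mulrA.
Qed.

(** On [u (x) A] the multiplier [u] acts, for [phi] and [d], as the scalar
    [s = r u]. If [s = 0] then [d] kills [u (x) a = u (p (x) a)]; otherwise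
    [a |-> d (u (x) a)] is a point derivation of [A] at the multiplicative
    functional [a |-> phi (u (x) a) / s]. *)
Lemma C0_character_derivation f : d f = 0.
Proof.
move: f; apply: tens_dense => p u a pu.
have [s0|s0] := eqVneq (r (cutoff_mult u)) 0.
  by rewrite -(tens_actE a pu) d_cutoff s0 mul0r.
set s := r (cutoff_mult u) in s0.
have uu b c : bmul (tens u b) (tens u c) = mult_act (cutoff_mult u) (tens u (bmul b c)).
  by rewrite tensM cutoff_actE.
have [du duE] := dual_tens d u; rewrite -duE.
apply: (@point_derivation0 (fun a => s^-1 * phi (tens u a))) => [k x y|x y|x y].
- rewrite tens_linear linearP mulrDr; congr (_ + _).
  by rewrite -[LHS]/(_ * (k * _)) mulrCA.
- have := phiM (tens u x) (tens u y); rewrite uu phi_act -/s => e.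
  have -> : phi (tens u (bmul x y)) = s^-1 * (phi (tens u x) * phi (tens u y)).
    by rewrite -e mulKf.
  by ring.
- have := dM (tens u x) (tens u y); rewrite uu d_cutoff -/s -!duE => e.
  have -> : du (bmul x y) = s^-1 * (phi (tens u x) * du y + phi (tens u y) * du x).
    by rewrite -e mulKf.
  by ring.
Qed.

End AtCharacter.

Theorem C0_point_amenable0 : point_amenable0 B.
Proof.
move=> phi chi d cd pd f; have [d' d'E] := dual_of_continuous cd.
rewrite -d'E; case: chi => [[phiM [g g0]]|phi0]; last first.
  by apply: C0_zero_derivation => x y; rewrite d'E pd !phi0 !mul0r addr0.
apply: (@C0_character_derivation phi d' ((phi g)^-1 *: g) phiM).
  by rewrite linearZ /= -[LHS]/((phi g)^-1 * phi g) mulVf.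
by move=> x y; rewrite !d'E pd.
Qed.

End PointDerivation.

(** * Derivations of [C0 X A] into its dual, for commutative [A] *)

Section WeakDense.
Variables (R : realType) (A : banachAlgType R).

(** A functional [l] killing products makes [a |-> l a * l] a derivation; if
    it is inner, evaluation at [a] gives [l a ^ 2 = 0]. *)
Lemma weakly_amenable_products : weakly_amenable A ->
  forall l : dual A, (forall a b, l (bmul a b) = 0) -> forall a, l a = 0.
Proof.
move=> wA l lM a; pose l' : dual (regular_bimod A) := l.
have [|||z zD] := @weakly_amenable_inner R A (fun a => l a *: l') (`|l'| * `|l'|) wA.
- by move=> k x y; rewrite dual_linear scalerDl scalerA.
- move=> b; rewrite normrZ mulrC -mulrA; apply: ler_wpM2l (dual_norm_ub l b).
  exact: (normr_ge0 l').
- move=> x y; apply: dual_ext => b.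
  rewrite -[RHS]/(l x * l (bmul y b) + l y * l (bmul b x)).
  by rewrite -[LHS]/(l (bmul x y) * l b) !lM !mulr0 mul0r addr0.
have : l a * l a = z (bmul a a) - z (bmul a a).
  exact: (congr1 (fun g : dual (regular_bimod A) => g a) (zD a)).
by rewrite subrr => /eqP; rewrite mulf_eq0 orbb => /eqP.
Qed.

End WeakDense.

Section C0Weak.
Variables (R : realType) (X : topologicalType) (A : banachAlgType R).
Hypothesis wA : weakly_amenable A.
Hypothesis cA : forall a b : A, bmul a b = bmul b a.
Local Notation B := (C0 X A).
Implicit Types (p q u w : cutoff R X) (m n : mult R X) (f g h : B).

Lemma mult_mulC m n : mult_mul m n = mult_mul n m.
Proof. by apply: mult_ext => x; rewrite /= mulrC. Qed.

Lemma C0_mulC f g : bmul f g = bmul g f.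
Proof. by apply: C0_ext => x; exact: cA. Qed.

Variable D : {linear B -> dual (regular_bimod B)}.
Hypothesis D_cont : continuous D.
Hypothesis D_der : derivation D.

Let DM f g k : D (bmul f g) k = D f (bmul g k) + D g (bmul f k).
Proof.
by rewrite D_der -[LHS]/(D f (bmul g k) + D g (bmul k f)) (C0_mulC k f).
Qed.

Let D_le : exists2 K : R[i], 0 <= K & forall f k, `|D f k| <= K * `|f| * `|k|.
Proof.
have [K K0 DK] := bounded_of_continuous D_cont; exists K => // f k.
by apply: le_trans (dual_norm_ub (D f) k) _; apply: ler_wpM2r (DK f).
Qed.

(* The failure of [D] to commute with multipliers, tested on products [h x]; it
   is a derivation in the multiplier, and so grows linearly along powers. *)
Let eta m g h x := D (mult_act m g) (bmul h x) - D g (mult_act m (bmul h x)).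

Let etaM m n g h x : eta (mult_mul m n) g h x =
  eta m g h (mult_act n x) + eta n g h (mult_act m x).
Proof.
have e1 := DM (mult_act (mult_mul m n) g) h x.
have e2 := DM (mult_act m g) (mult_act n h) x.
have e3 := DM (mult_act n g) h (mult_act m x).
have e4 := DM g (mult_act n h) (mult_act m x).
have e12 : bmul (mult_act (mult_mul m n) g) h = bmul (mult_act m g) (mult_act n h).
  by rewrite mult_actMl mult_actMr mult_actMl -!mult_actM mult_mulC.
have e34 : bmul (mult_act n g) h = bmul g (mult_act n h).
  by rewrite mult_actMl mult_actMr.
rewrite /eta; rewrite e12 e2 in e1; rewrite e34 e4 in e3.
have p1 : bmul (mult_act n h) x = bmul h (mult_act n x).
  by rewrite mult_actMl mult_actMr.
have p2 : bmul (mult_act m g) x = bmul g (mult_act m x).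
  by rewrite mult_actMl mult_actMr.
have p3 : bmul (mult_act (mult_mul m n) g) x = bmul (mult_act n g) (mult_act m x).
  by rewrite !mult_actMl mult_actMr -mult_actM mult_mulC.
have p4 : bmul (mult_act n h) (mult_act m x) = mult_act (mult_mul m n) (bmul h x).
  by rewrite mult_actMl mult_actMr -mult_actM mult_mulC.
have p5 : mult_act m (bmul h (mult_act n x)) = mult_act (mult_mul m n) (bmul h x).
  by rewrite mult_actMr -mult_actM.
have p6 : mult_act n (bmul h (mult_act m x)) = mult_act (mult_mul m n) (bmul h x).
  by rewrite mult_actMr -mult_actM mult_mulC.
rewrite p1 p2 p3 in e1; rewrite p4 in e3; rewrite p5 p6.
have {e1}-> : D (mult_act (mult_mul m n) g) (bmul h x) =
    D (mult_act m g) (bmul h (mult_act n x)) + D (mult_act n h) (bmul g (mult_act m x))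
    - D h (bmul (mult_act n g) (mult_act m x)) by rewrite e1 addrK.
have {e3}-> : D (mult_act n h) (bmul g (mult_act m x)) =
    D (mult_act n g) (bmul h (mult_act m x)) + D h (bmul (mult_act n g) (mult_act m x))
    - D g (mult_act (mult_mul m n) (bmul h x)) by rewrite -e3 addrC addKr.
by ring.
Qed.

Let eta1 g h x : eta (mult_one R X) g h x = 0.
Proof.
have one_act f : mult_act (mult_one R X) f = f.
  by apply: C0_ext => y; rewrite /= scale1r.
by rewrite /eta !one_act subrr.
Qed.

Let eta_um (v : unim R X) g h x : eta v g h x = 0.
Proof.
have etapow k y : eta (mult_pow v k.+1) g h y =
    k.+1%:R * eta v g h (mult_act (mult_pow v k) y).
  elim: k y => [|k IH] y.
    rewrite -[mult_pow v 1]/(mult_mul v (mult_one R X)) etaM eta1 addr0 mul1r.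
    by [].
  rewrite -[mult_pow v k.+2]/(mult_mul v (mult_pow v k.+1)) etaM IH -mult_actM.
  rewrite (mult_mulC _ v) -[mult_mul v (mult_pow v k)]/(mult_pow v k.+1).
  by rewrite [k.+2%:R]mulrSr; ring.
have [K K0 DK] := D_le.
pose C := K * `|g| * (`|h| * `|x|).
apply: (@linear_growth0 _ _ (C + C)) => -[|k].
  by rewrite mul0r addr_ge0// !mulr_ge0.
have [w wE] := mult_pow_inv A v k.
have -> : k.+1%:R * `|eta v g h x| = `|eta (mult_pow v k.+1) g h (mult_act w x)|.
  by rewrite etapow wE normrM normr_nat.
have hw : `|bmul h (mult_act w x)| <= `|h| * `|x|.
  by apply: le_trans (bnormM _ _) _; rewrite ler_wpM2l ?mult_act_norm.
apply: le_trans (ler_normB _ _) _; rewrite lerD//; apply: le_trans (DK _ _) _.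
  by apply: ler_pM => //; rewrite ?mulr_ge0// ler_wpM2l ?mult_act_norm.
apply: ler_pM => //; first by rewrite mulr_ge0.
exact: le_trans (mult_act_norm _ _) hw.
Qed.

(* [D] commutes with cutoffs: when tested on products because [eta] vanishes,
   then in general because products span a dense subspace of [A]. *)
Let D_cutoff u w p (b : A) g : (forall x, p x * w x = w x) ->
  D (mult_act (cutoff_mult u) g) (tens w b) =
  D g (mult_act (cutoff_mult u) (tens w b)).
Proof.
move=> pw; have [v [v' uE]] := cutoff_um u.
have onM h x : D (mult_act (cutoff_mult u) g) (bmul h x) =
    D g (mult_act (cutoff_mult u) (bmul h x)).
  have ev (z : unim R X) : D (mult_act z g) (bmul h x) = D g (mult_act z (bmul h x)).
    by apply/eqP; rewrite -subr_eq0; apply/eqP; exact: eta_um.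
  rewrite !(act_halves _ uE) dual_appZ dual_appD -!ev linearZ linearD.
  by [].
have [l1 l1E] := dual_tens (D (mult_act (cutoff_mult u) g) : dual B) w.
have [l2 l2E] := dual_tens (D g : dual B) (cutoff_mul u w).
apply/eqP; rewrite -subr_eq0 cutoff_actE -l1E -l2E; apply/eqP.
apply: (weakly_amenable_products wA (l := l1 - l2)) => a c.
have -> : (l1 - l2) (bmul a c) = l1 (bmul a c) - l2 (bmul a c) by [].
rewrite l1E l2E -cutoff_actE -(tens_unitM a c pw) onM.
by rewrite subrr.
Qed.

(* As [p] acts as the identity next to [u], the map
   [a |-> D (p (x) a) (u (x) _)] is a derivation of [A] into its dual. *)
Let D_local p u : (forall x, p x * u x = u x) ->
  forall a b, D (tens p a) (tens u b) = 0.
Proof.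
move=> pu.
have Du_subproof a :
    (fun b => D (tens p a) (tens u b)) \in @dual_pred R (regular_bimod A).
  apply: (@dual_predP _ _ _ `|D (tens p a)|) => [k x y|x].
    by rewrite tens_linear dual_linear.
  apply: le_trans (dual_norm_ub (D (tens p a)) _) _.
  by rewrite ler_wpM2l ?(normr_ge0 (D (tens p a))) ?tens_norm.
pose Du a : dual (regular_bimod A) := MkDual (Du_subproof a).
have [K K0 DK] := D_le.
have Du0 : forall a, Du a = 0.
  apply: (inner_commutative cA); apply: (weakly_amenable_inner (K := K) wA).
  - by move=> k x y; apply: dual_ext => b; rewrite /= tens_linear linearP.
  - move=> a; apply: dual_norm_le => [|b]; first by rewrite mulr_ge0.
    apply: le_trans (DK _ _) _; apply: ler_pM; rewrite ?mulr_ge0 ?tens_norm//.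
    by rewrite ler_wpM2l ?tens_norm.
  - move=> a b; apply: dual_ext => c.
    rewrite -[RHS]/(D (tens p a) (tens u (bmul b c)) +
      D (tens p b) (tens u (bmul c a))).
    rewrite (cA c a) -!(tens_unitM _ _ pu) -DM tensM -cutoff_actE.
    rewrite (D_cutoff _ _ _ pu) cutoff_actE; congr (D _ _).
    by apply: C0_ext => x; rewrite /= cutoff_mulE pu.
by move=> a b; rewrite -[LHS]/(Du a b) Du0.
Qed.

(** For [p u = u], moving [p] and then [w] across [D] gives
    [D (w (x) a) (u (x) b) = D (p (x) a) (w u (x) b)], and [p] is a local unit
    for [w u]. *)
Lemma C0_derivation0 f : D f = 0.
Proof.
apply: dual_ext => k; rewrite -[RHS]/(0 : (R[i])^o).
move: k; apply: (tens_dense (psi := D f : dual B)) => p u b pu.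
have [K K0 DK] := D_le.
have [||d dE] := @dual_exists R B (fun f => D f (tens u b)).
- by move=> c x y; rewrite linearP.
- exists (K * `|tens u b|) => g; rewrite mulrAC; exact: DK.
rewrite -dE; move: f; apply: tens_dense => q w a qw; rewrite dE.
have puE : mult_act (cutoff_mult p) (tens u b) = tens u b.
  by rewrite cutoff_actE; apply: C0_ext => x; rewrite /= cutoff_mulE pu.
have -> : D (tens w a) (tens u b) = D (mult_act (cutoff_mult p) (tens w a)) (tens u b).
  by rewrite (D_cutoff _ _ _ pu) puE.
have -> : mult_act (cutoff_mult p) (tens w a) = mult_act (cutoff_mult w) (tens p a).
  by rewrite !cutoff_actE; apply: C0_ext => x; rewrite /= !cutoff_mulE mulrC.
rewrite (D_cutoff _ _ _ pu) cutoff_actE; apply: D_local => x.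
by rewrite cutoff_mulE mulrCA pu.
Qed.

End C0Weak.

Theorem C0_weakly_amenable (R : realType) (X : topologicalType)
    (A : banachAlgType R) :
  (forall a b : A, bmul a b = bmul b a) ->
  weakly_amenable A -> weakly_amenable (C0 X A).
Proof.
move=> cA wA D cD dD; exists 0 => f.
rewrite (C0_derivation0 wA cA cD dD); apply: dual_ext => k.
by rewrite -[RHS]/(0 - 0 : (R[i])^o) subr0.
Qed.

Theorem theorem5p1 (R : realType) (X : topologicalType) (A : banachAlgType R)
    (X_nonempty : [set: X] !=set0) (X_hausdorff : hausdorff_space X)
    (X_locally_compact : locally_compact [set: X]) :
  (amenable (C0 X A) <-> amenable A) /\
  (point_amenable0 (C0 X A) <-> point_amenable0 A) /\
  ((forall a b : A, bmul a b = bmul b a) ->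
   (weakly_amenable (C0 X A) <-> weakly_amenable A)).
Proof.
have [x0 _] := X_nonempty.
have ev_surj := @C0_eval_surj R X A x0 X_hausdorff X_locally_compact.
have evM (f g : C0 X A) : C0_eval x0 (bmul f g) = bmul (C0_eval x0 f) (C0_eval x0 g).
  by [].
split; last split.
- split; first exact: (amenable_quotient evM (@C0_eval_norm _ _ _ x0) ev_surj).
  move=> /amenable_virtual_diagonalP[M vdM]; apply/amenable_virtual_diagonalP.
  exact: C0_virtual_diagonal vdM.
- split; last by move=> pA; exact: (@C0_point_amenable0 R A pA X).
  exact: (point_amenable0_quotient evM (@C0_eval_norm _ _ _ x0) ev_surj).
- move=> cA; split; last exact: C0_weakly_amenable.
  apply: (weakly_amenable_quotient evM (@C0_eval_norm _ _ _ x0) ev_surj).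
  by move=> f g; exact: C0_mulC.
Qed.
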